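(* Every SUN distribution is log-concave: if $Y\sim\mathrm{SUN}_{d,m}(\xi,\Omega,\Delta,\tau,\Gamma)$, with parameters as specified in the context, then the logarithm of the density $f_Y$ of $Y$ is a concave function on $\mathbb{R}^d$.
   Context: Let $d,m$ be positive integers. Let $\Omega^*=\begin{pmatrix}\bar\Omega&\Delta\\ \Delta^{\top}&\Gamma\end{pmatrix}$ be a full-rank $(d+m)\times(d+m)$ correlation matrix ($\bar\Omega$ is $d\times d$, $\Delta$ is $d\times m$, $\Gamma$ is $m\times m$), let $\tau\in\mathbb{R}^m$, $\xi\in\mathbb{R}^d$, let $\omega$ be a $d\times d$ diagonal matrix with positive diagonal elements, and $\Omega=\omega\bar\Omega\omega$. If $(X_0,X_1)\sim \mathrm{N}_{d+m}(0,\Omega^* )$, with $X_0$ of dimension $d$, $\mathrm{SUN}_{d,m}(\xi,\Omega,\Delta,\tau,\Gamma)$ denotes the distribution of $\xi+\omega Z$, where $Z$ has the distribution of $X_0$ conditional on $X_1+\tau>0$ (componentwise). Its density is $$f_Y(x)=\varphi_d(x-\xi;\Omega)\,\frac{\Phi_m\{\tau+\Delta^{\top}\bar\Omega^{-1}\omega^{-1}(x-\xi);\ \Gamma-\Delta^{\top}\bar\Omega^{-1}\Delta\}}{\Phi_m(\tau;\Gamma)},\qquad x\in\mathbb{R}^d,$$ where $\varphi_h(u;S)$ and $\Phi_h(u;S)$ denote the density and distribution function of $\mathrm{N}_h(0,S)$ at $u$. Log-concavity of a distribution with a density means that the logarithm of the density is a concave function. It is equivalently expressed through the probability measure by $\mathbb{P}\{\lambda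 A+(1-\lambda)B\}\ge\mathbb{P}\{A\}^{\lambda}\,\mathbb{P}\{B\}^{1-\lambda}$ for any two Borel sets $A,B$ and any $0<\lambda<1$. *)

(* Defs.v *)
From HB Require Import structures.
From mathcomp Require Import all_boot all_order all_algebra.
From mathcomp Require Import all_classical all_reals all_analysis.

Set Implicit Arguments.
Unset Strict Implicit.
Unset Printing Implicit Defensive.

Import Order.TTheory GRing.Theory Num.Theory.
Import numFieldNormedType.Exports.

Local Open Scope classical_set_scope.
Local Open Scope ring_scope.

(* R^n is 'cV[R]_n with the sigma-algebra generated by the coordinates, i.e.
   its Borel sigma-algebra; the library only equips n.-tuple R with it. *)
Section measurable_cV.
Context {R : realType} {n : nat}.

Let coord (i : 'I_n) (v : 'cV[R]_n) : R := v i ord0.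

Let cV_set0 : g_sigma_preimage coord set0.
Proof. exact: sigma_algebra0. Qed.

Let cV_setC A : g_sigma_preimage coord A -> g_sigma_preimage coord (~` A).
Proof. exact: sigma_algebraC. Qed.

Let cV_bigcup (F : (set 'cV[R]_n)^nat) :
  (forall i, g_sigma_preimage coord (F i)) ->
  g_sigma_preimage coord (\bigcup_i (F i)).
Proof. exact: sigma_algebra_bigcup. Qed.

HB.instance Definition _ := @isMeasurable.Build
  (measure_tuple_display default_measure_display) 'cV[R]_n
  (g_sigma_preimage coord) cV_set0 cV_setC cV_bigcup.

Lemma measurable_coord (i : 'I_n) :
  measurable_fun [set: 'cV[R]_n] (fun v => v i ord0 : R).
Proof.
move=> _ Y mY; rewrite setTI; apply: sub_sigma_algebra => /=.
rewrite -bigcup_seq/=; exists i => /=; first by rewrite mem_index_enum.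
by exists Y => //; rewrite setTI.
Qed.

Lemma measurable_fun_cVP d (T : measurableType d) (f : T -> 'cV[R]_n) :
  measurable_fun [set: T] f <->
  forall i, measurable_fun [set: T] (fun t => f t i ord0 : R).
Proof.
split=> [mf i|mf].
  exact: (measurableT_comp (measurable_coord i) mf).
apply: (@measurability _ _ _ _ _ _
  (\big[setU/set0]_(i < n) preimage_set_system setT (coord i) measurable)) => //.
move=> _ [B HB <-]; move: HB.
rewrite -bigcup_seq => -[i _ [C mC <-]].
rewrite !setTI -comp_preimage -[X in measurable X]setTI.
exact: mf.
Qed.

End measurable_cV.

(* Lebesgue measure on R^n, peeling off the first coordinate. *)
Fixpoint lebesgue_cV (R : realType) (n : nat) : set 'cV[R]_n -> \bar R :=
  match n with
  | 0 => \d_(0 : 'cV[R]_0)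
  | n'.+1 => fun A => ((@lebesgue_measure R) \x @lebesgue_cV R n')%E
      [set p : measurableTypeR R * 'cV[R]_n' | A (col_mx (const_mx p.1 : 'cV[R]_1) p.2)]
  end.

Section lebesgue_cV_measure.
Context {R : realType}.

Let cons_cV n (p : measurableTypeR R * 'cV[R]_n) : 'cV[R]_n.+1 :=
  col_mx (const_mx p.1 : 'cV[R]_1) p.2.

Let uncons_cV n (v : 'cV[R]_n.+1) : measurableTypeR R * 'cV[R]_n :=
  (v ord0 ord0, @dsubmx R 1 n 1 v).

Let cons_cVK n : cancel (@cons_cV n) (@uncons_cV n).
Proof.
move=> [x v]; rewrite /uncons_cV /cons_cV/= col_mxKd; congr pair.
have -> : ord0 = lshift n ord0 :> 'I_(1 + n) by exact/val_inj.
exact: etrans (@col_mxEu R 1 n 1 (const_mx x) v ord0 ord0) (mxE _ _ _ _).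
Qed.

Let uncons_cVK n : cancel (@uncons_cV n) (@cons_cV n).
Proof.
move=> v; apply: etrans (@vsubmxK R 1 n 1 v); rewrite /cons_cV /uncons_cV /=.
congr (@col_mx R 1 n 1 _ _); apply/matrixP => i j; rewrite !mxE !ord1.
by congr (v _ _); exact/val_inj.
Qed.

Let measurable_cons_cV n : measurable_fun [set: measurableTypeR R * 'cV[R]_n] (@cons_cV n).
Proof.
apply/measurable_fun_cVP => i.
case: (@splitP 1 n i) => [j ij|j ij].
  rewrite [X in measurable_fun _ X](_ : _ = fst)//.
  apply/funext => -[x v]; rewrite /cons_cV/=.
  have -> : i = lshift n j by exact/val_inj.
  exact: etrans (@col_mxEu R 1 n 1 (const_mx x) v j ord0) (mxE _ _ _ _).
rewrite [X in measurable_fun _ X](_ : _ = (fun v : 'cV[R]_n => v j ord0 : R) \o snd).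
  by apply: measurableT_comp => //; exact: measurable_coord.
apply/funext => -[x v]; rewrite /cons_cV/=.
have -> : i = rshift 1 j by exact/val_inj.
exact: (@col_mxEd R 1 n 1 (const_mx x) v j ord0).
Qed.

Let measurable_uncons_cV n : measurable_fun [set: 'cV[R]_n.+1] (@uncons_cV n).
Proof.
apply: measurable_fun_pair; first exact: measurable_coord.
apply/measurable_fun_cVP => i.
rewrite [X in measurable_fun _ X](_ : _ = fun v : 'cV[R]_n.+1 => v (rshift 1 i : 'I_n.+1) ord0).
  exact: measurable_coord.
by apply/funext => v; rewrite mxE.
Qed.

Section cons_measure.
Context n (mu : {sigma_finite_measure set 'cV[R]_n -> \bar R}).

Local Notation nu := ((@lebesgue_measure R) \x mu)%E.

Definition cons_measure (A : set 'cV[R]_n.+1) := nu (@cons_cV n @^-1` A).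

Let measurable_preimage A :
  measurable A -> measurable (@cons_cV n @^-1` A).
Proof.
by move=> mA; rewrite -[X in measurable X]setTI; exact: measurable_cons_cV.
Qed.

Let cons_measure0 : cons_measure set0 = 0%E.
Proof. by rewrite /cons_measure preimage_set0 measure0. Qed.

Let cons_measure_ge0 A : (0 <= cons_measure A)%E.
Proof. exact: measure_ge0. Qed.

Let cons_measure_sigma_additive : semi_sigma_additive cons_measure.
Proof.
move=> F mF tF mUF; rewrite /cons_measure preimage_bigcup.
apply: (measure_semi_sigma_additive (fun i => @cons_cV n @^-1` F i)).
- by move=> i; exact: measurable_preimage.
- apply/trivIsetP => /= i j _ _ ij; rewrite -preimage_setI.
  by move/trivIsetP : tF => /(_ _ _ _ _ ij) ->//; rewrite preimage_set0.
- by rewrite -preimage_bigcup; exact: measurable_preimage.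
Qed.

HB.instance Definition _ := isMeasure.Build _ _ _ cons_measure
  cons_measure0 cons_measure_ge0 cons_measure_sigma_additive.

Let cons_measure_sigma_finite : sigma_finite setT cons_measure.
Proof.
have /sigma_finiteP[F [TF ndF Foo]] := sigma_finiteT (@lebesgue_measure R).
have /sigma_finiteP[G [TG ndG Goo]] := sigma_finiteT mu.
exists (fun k => @uncons_cV n @^-1` (F k `*` G k)).
  rewrite -preimage_bigcup (_ : \bigcup_k _ = setT) ?preimage_setT//.
  rewrite -setXTT TF TG predeqE => -[x y]; split.
    by move=> [k _ []/= ? ?]; split; exists k.
  move=> [/= [i _ Fix] [k _ Gky]]; exists (maxn i k) => //; split.
  - by move: x Fix; exact/subsetPset/ndF/leq_maxl.
  - by move: y Gky; exact/subsetPset/ndG/leq_maxr.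
move=> k; have [? ?] := Foo k; have [? ?] := Goo k; split.
  rewrite -[X in measurable X]setTI.
  by apply: measurable_uncons_cV => //; exact: measurableX.
rewrite /cons_measure -comp_preimage (_ : _ \o _ = id); last first.
  by apply/funext => p /=; rewrite cons_cVK.
by rewrite preimage_id product_measure1E// lte_mul_pinfty// ge0_fin_numE.
Qed.

HB.instance Definition _ := Measure_isSigmaFinite.Build _ _ _ cons_measure
  cons_measure_sigma_finite.

End cons_measure.

Let lebesgue_cV_measure n :
  exists mu : {sigma_finite_measure set 'cV[R]_n -> \bar R},
    @lebesgue_cV R n = mu.
Proof.
elim: n => [|n [mu IH]]; first by exists (\d_(0 : 'cV[R]_0)).
by exists (cons_measure mu); apply/funext => A /=; rewrite IH.
Qed.

Let lebesgue_cV0 n : @lebesgue_cV R n set0 = 0%E.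
Proof. by have [mu ->] := lebesgue_cV_measure n; exact: measure0. Qed.

Let lebesgue_cV_ge0 n A : (0 <= @lebesgue_cV R n A)%E.
Proof. by have [mu ->] := lebesgue_cV_measure n; exact: measure_ge0. Qed.

Let lebesgue_cV_sigma_additive n : semi_sigma_additive (@lebesgue_cV R n).
Proof.
by have [mu ->] := lebesgue_cV_measure n; exact: measure_semi_sigma_additive.
Qed.

HB.instance Definition _ n := isMeasure.Build _ _ _ (@lebesgue_cV R n)
  (@lebesgue_cV0 n) (@lebesgue_cV_ge0 n) (@lebesgue_cV_sigma_additive n).

Let lebesgue_cV_sigma_finite n : sigma_finite setT (@lebesgue_cV R n).
Proof. by have [mu ->] := lebesgue_cV_measure n; exact: sigma_finiteT. Qed.

HB.instance Definition _ n := Measure_isSigmaFinite.Build _ _ _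
  (@lebesgue_cV R n) (@lebesgue_cV_sigma_finite n).

End lebesgue_cV_measure.

Definition correlation_mx (R : realType) (n : nat) (C : 'M[R]_n) : Prop :=
  [/\ C^T = C, forall i, C i i = 1 &
      forall v : 'cV[R]_n, 0 <= (v^T *m C *m v) ord0 ord0].

Section multivariate_normal.
Context {R : realType} {n : nat}.

(* The centred normal law N_n(0, S), for a positive definite covariance S. *)
Definition mvn_pdf (S : 'M[R]_n) (x : 'cV[R]_n) : R :=
  (Num.sqrt ((2 * pi) ^+ n * \det S))^-1 *
  expR (- (x^T *m invmx S *m x) ord0 ord0 / 2).

Definition mvn_prob (S : 'M[R]_n) (A : set 'cV[R]_n) : \bar R :=
  (\int[@lebesgue_cV R n]_(x in A) (mvn_pdf S x)%:E)%E.

Definition mvn_cdf (S : 'M[R]_n) (u : 'cV[R]_n) : R :=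
  fine (mvn_prob S [set y | forall i, y i ord0 <= u i ord0]).

End multivariate_normal.

Definition conditional (R : realType) (T : Type) (mu : set T -> \bar R)
  (B A : set T) : \bar R := (fine (mu (A `&` B)) / fine (mu B))%:E.

(* The matrices Obar and omega are arguments in place of the covariance
   parameter Omega = omega *m Obar *m omega. *)
Section sun.
Context {R : realType} {d m : nat}.
Variables (xi : 'cV[R]_d) (omega Obar : 'M[R]_d) (Delta : 'M[R]_(d, m))
          (tau : 'cV[R]_m) (Gamma : 'M[R]_m).

Definition sun_mx : 'M[R]_(d + m) := block_mx Obar Delta Delta^T Gamma.

(* Law of xi + omega Z, where Z is X0 conditional on X1 + tau > 0 and
   (X0, X1) ~ N(0, sun_mx): X0 = usubmx x, X1 = dsubmx x. *)
Definition sun_law (A : set 'cV[R]_d) : \bar R :=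
  conditional (mvn_prob sun_mx)
    [set x : 'cV[R]_(d + m) | forall i, 0 < (dsubmx x + tau) i ord0]
    [set x : 'cV[R]_(d + m) | A (xi + omega *m usubmx x)].

Definition sun_pdf (x : 'cV[R]_d) : R :=
  mvn_pdf (omega *m Obar *m omega) (x - xi) *
  (mvn_cdf (Gamma - Delta^T *m invmx Obar *m Delta)
     (tau + Delta^T *m invmx Obar *m invmx omega *m (x - xi)) /
   mvn_cdf Gamma tau).

End sun.

Definition has_density (R : realType) (n : nat) (disp : measure_display)
    (T : measurableType disp) (P : probability T R) (Y : {RV P >-> 'cV[R]_n})
    (f : 'cV[R]_n -> R) : Prop :=
  [/\ measurable_fun [set: 'cV[R]_n] f, forall x, 0 <= f x &
      forall A, measurable A ->
        distribution P Y A = (\int[@lebesgue_cV R n]_(x in A) (f x)%:E)%E].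

Definition concave_function (R : realType) (E : lmodType R) (f : E -> R) :=
  @convex_function R E [set: E] (fun x => - f x).

(* Main.v *)
Require Import Defs.
From mathcomp Require Import all_boot all_order all_algebra.
From mathcomp Require Import all_classical all_reals all_analysis.
From mathcomp Require Import measurable_realfun ring lra.

Set Implicit Arguments.
Unset Strict Implicit.
Unset Printing Implicit Defensive.

Import Order.TTheory GRing.Theory Num.Theory.
Import numFieldNormedType.Exports.

Local Open Scope classical_set_scope.
Local Open Scope ring_scope.

(** The SUN density is the normal density $\varphi_d$ times the normal
    distribution function $\Phi_m$ composed with an affine map, divided by a
    constant. Products and affine substitutions preserve log-concavity, and
    $\log \varphi_d$ is a concave quadratic, so log-concavity reduces to that of
    $\Phi_m$ ([mvn_cdf_log_concave]).

    The latter goes by induction on the dimension. Conditioning on the first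
    coordinate writes $\Phi_{1+n}(u_1, u')$ as the integral over $t \le u_1$ of
    $\varphi_1(t) \Phi_n(u' - b t)$, where $b$ is the vector of regression
    coefficients and the covariance of $\Phi_n$ is a Schur complement. By
    induction the integrand, cut off at $t \le u_1$, is log-concave in $(u, t)$
    jointly, and integrating out $t$ preserves log-concavity by the
    one-dimensional Prekopa-Leindler inequality ([prekopa_leindler]). That
    inequality in turn comes from comparing the lengths of level sets by
    Brunn-Minkowski on the line.

    That $f_Y$ is the density of the law of $Y$ is the computation of
    $P(X_0 \in D, X_1 + \tau > 0)$ by Fubini, with one factorisation of the
    joint density for each order of integration. Integrating over $X_1$ first
    gives the numerator $\varphi_d(x) \Phi_m(\tau + \Delta^T \bar\Omega^{-1} x)$
    ([mvn_prob_selection]). Taking for $D$ the whole space and integrating over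
    $X_0$ first gives the normalising constant $\Phi_m(\tau; \Gamma)$
    ([mvn_prob_tail]). The change of variables $x \mapsto \xi + \omega x$
    then turns the law of $Z$ into that of $Y$ ([sun_law_density]). *)

(** * Positive definite matrices and Schur complements *)

Section quadratic_form.
Context {R : realType}.

Definition qform n (K : 'M[R]_n) (x y : 'cV[R]_n) : R :=
  (x^T *m K *m y) ord0 ord0.

Lemma qformDl n (K : 'M[R]_n) x y z : qform K (x + y) z = qform K x z + qform K y z.
Proof. by rewrite /qform linearD/= !mulmxDl mxE. Qed.

Lemma qformDr n (K : 'M[R]_n) x y z : qform K z (x + y) = qform K z x + qform K z y.
Proof. by rewrite /qform !mulmxDr mxE. Qed.

Lemma qformZl n (K : 'M[R]_n) a x y : qform K (a *: x) y = a * qform K x y.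
Proof. by rewrite /qform linearZ/= -!scalemxAl mxE. Qed.

Lemma qformZr n (K : 'M[R]_n) a x y : qform K x (a *: y) = a * qform K x y.
Proof. by rewrite /qform -!scalemxAr mxE. Qed.

Lemma qformNN n (K : 'M[R]_n) x : qform K (- x) (- x) = qform K x x.
Proof. by rewrite -scaleN1r qformZl qformZr mulrA mulrNN !mul1r. Qed.

Lemma qform_tr n (K : 'M[R]_n) x y : qform K x y = qform K^T y x.
Proof.
transitivity ((x^T *m K *m y)^T ord0 ord0); first by rewrite mxE.
by rewrite !trmx_mul trmxK mulmxA.
Qed.

(** The defect of convexity is $a (1 - a)$ times the form at $x - y$. *)
Lemma qform_convex n (K : 'M[R]_n) (x y : 'cV[R]_n) (a : R) :
  (forall v, 0 <= qform K v v) -> 0 <= a -> a <= 1 ->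
  qform K (a *: x + (1 - a) *: y) (a *: x + (1 - a) *: y) <=
  a * qform K x x + (1 - a) * qform K y y.
Proof.
move=> K0 a0 a1; have := K0 (x - y).
rewrite -scaleN1r !(qformDl, qformDr, qformZl, qformZr) => Kxy.
rewrite -subr_ge0.
set xx := qform K x x in Kxy *; set yy := qform K y y in Kxy *.
set xy := qform K x y in Kxy *; set yx := qform K y x in Kxy *.
rewrite (_ : _ - _ = (a * (1 - a)) * (xx + -1 * xy + (-1 * yx + -1 * (-1 * yy))));
  last ring.
by rewrite mulr_ge0// ?mulr_ge0 ?subr_ge0//.
Qed.

Definition posdef n (S : 'M[R]_n) : Prop :=
  S^T = S /\ forall v : 'cV[R]_n, v != 0 -> 0 < qform S v v.

Lemma posdef_unitmx n (S : 'M[R]_n) : posdef S -> S \in unitmx.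
Proof.
move=> [_ S0]; rewrite -row_free_unit -kermx_eq0; apply/negPn/negP => /rowV0Pn[v].
move=> /sub_kermxP vS v0.
have := S0 v^T; rewrite /qform trmxK vS mul0mx mxE ltxx => /(_ _)/negP; apply => //.
by rewrite -(inj_eq (can_inj (@trmxK _ _ _))) trmxK trmx0.
Qed.

Lemma posdef_ge0 n (S : 'M[R]_n) v : posdef S -> 0 <= qform S v v.
Proof.
move=> [_ S0]; have [->|/S0/ltW//] := eqVneq v 0.
by rewrite /qform mulmx0 mxE.
Qed.

Lemma posdef_congr n (S W : 'M[R]_n) :
  W \in unitmx -> posdef S -> posdef (W^T *m S *m W).
Proof.
move=> uW [symS S0]; split; first by rewrite !trmx_mul trmxK symS mulmxA.
move=> v v0; rewrite /qform.
have -> : v^T *m (W^T *m S *m W) *m v = (W *m v)^T *m S *m (W *m v).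
  by rewrite trmx_mul !mulmxA.
apply: S0; apply: contra v0 => /eqP Wv0.
by rewrite -(mulKmx uW v) Wv0 mulmx0.
Qed.

Lemma posdef_inv n (S : 'M[R]_n) : posdef S -> posdef (invmx S).
Proof.
move=> pS; have uS := posdef_unitmx pS.
have -> : invmx S = (invmx S)^T *m S *m invmx S.
  by rewrite trmx_inv pS.1 mulVmx// mul1mx.
by apply: posdef_congr => //; rewrite unitmx_inv.
Qed.

(** A vector $v$ with $v^T S v = 0$ minimises the quadratic form, so the linear
    term of $t \mapsto (v + t w)^T S (v + t w)$ vanishes; for $w = S v$ this
    says that $S v = 0$. *)
Lemma psd_unitmx_posdef n (S : 'M[R]_n) : S^T = S ->
  (forall v : 'cV[R]_n, 0 <= qform S v v) -> S \in unitmx -> posdef S.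
Proof.
move=> symS S0 uS; split=> // v v0; rewrite lt_neqAle S0 andbT eq_sym.
apply: contra v0 => /eqP vSv.
suff Sv0 : S *m v = 0 by rewrite -(mulKmx uS v) Sv0 mulmx0.
pose w := S *m v.
have sym : qform S w v = qform S v w.
  by rewrite qform_tr symS.
have vw : qform S v w = \sum_i w i ord0 ^+ 2.
  rewrite -sym /qform -mulmxA -/w mxE; apply: eq_bigr => i _.
  by rewrite mxE expr2.
have vw0 : 0 <= qform S v w by rewrite vw sumr_ge0// => i _; rewrite sqr_ge0.
have vw_eq0 : qform S v w = 0.
  apply/eqP; rewrite eq_le vw0 andbT leNgt; apply/negP => vw_gt0.
  have := S0 w; set q := qform S w w => q0.
  have q1 : 0 < q + 1 by rewrite ltr_wpDl.
  (* the quadratic 2 t a + t^2 q is negative at t = - a / (q + 1) *)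
  have := S0 (v + (- (qform S v w / (q + 1))) *: w).
  rewrite !(qformDl, qformDr, qformZl, qformZr) sym vSv -/q.
  set a := qform S v w in vw_gt0 *.
  rewrite (_ : _ + _ = - (a ^+ 2 * (q + 2) / (q + 1) ^+ 2)); last first.
    by field; rewrite gt_eqF.
  rewrite oppr_ge0 leNgt => /negP; apply.
  by rewrite divr_gt0 ?mulr_gt0 ?exprn_gt0// ltr_wpDl.
move: vw_eq0; rewrite vw => /eqP; rewrite psumr_eq0; last by move=> i _; exact: sqr_ge0.
move=> /allP w0; apply/matrixP => i j; rewrite ord1 [RHS]mxE.
by have := w0 i (mem_index_enum _); rewrite /= sqrf_eq0 => /eqP.
Qed.

(** The form of the inverse is evaluated by solving a linear system. *)
Lemma qform_dot n (K : 'M[R]_n) (z w : 'cV[R]_n) :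
  K \in unitmx -> K *m w = z -> qform (invmx K) z z = (z^T *m w) ord0 ord0.
Proof. by move=> uK <-; rewrite /qform -!mulmxA mulKmx. Qed.

Lemma dot_col_mx d m (x x' : 'cV[R]_d) (y y' : 'cV[R]_m) :
  ((col_mx x y)^T *m col_mx x' y') ord0 ord0 =
  (x^T *m x') ord0 ord0 + (y^T *m y') ord0 ord0.
Proof. by rewrite tr_col_mx mul_row_col mxE. Qed.

End quadratic_form.

Section schur.
Context {R : realType} {d m : nat}.
Implicit Types (A : 'M[R]_d) (B : 'M[R]_(d, m)) (C : 'M[R]_m).

Definition schur A B C : 'M[R]_m := C - B^T *m invmx A *m B.

Lemma posdef_ul A B C : posdef (block_mx A B B^T C) -> posdef A.
Proof.
move=> [sM M0]; split.
  by move: sM; rewrite tr_block_mx => /eq_block_mx[].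
move=> x x0; have := M0 (col_mx x 0).
rewrite /qform -mulmxA mul_block_col dot_col_mx !mulmx0 !addr0 trmx0 mul0mx.
rewrite [X in _ + X]mxE addr0 mulmxA; apply.
by apply: contra x0 => /eqP; rewrite -col_mx0 => /eq_col_mx[->].
Qed.

Lemma posdef_schur A B C : posdef (block_mx A B B^T C) -> posdef (schur A B C).
Proof.
move=> pM; have uA := posdef_unitmx (posdef_ul pM); have sA := (posdef_ul pM).1.
case: pM => sM M0; split.
  rewrite /schur linearB/= !trmx_mul trmxK trmx_inv sA mulmxA.
  by congr (_ - _); move: sM; rewrite tr_block_mx => /eq_block_mx[].
move=> y y0; have := M0 (col_mx (- (invmx A *m B *m y)) y).
rewrite /qform -[_ *m block_mx _ _ _ _ *m _]mulmxA mul_block_col dot_col_mx.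
rewrite !mulmxN !mulmxA mulmxV// mul1mx.
rewrite addNr mulmx0 [X in X + _]mxE add0r.
suff -> : y^T *m (- (B^T *m invmx A *m B *m y) + C *m y) =
          y^T *m schur A B C *m y.
  apply; apply: contra y0 => /eqP.
  by rewrite -(@col_mx0 _ d m 1) => /eq_col_mx[_ ->].
by rewrite -[RHS]mulmxA /schur mulmxBl addrC.
Qed.

Lemma block_swap_mul A B C (w1 : 'cV[R]_d) (w2 : 'cV[R]_m) x y :
  block_mx A B B^T C *m col_mx w1 w2 = col_mx x y ->
  block_mx C B^T B A *m col_mx w2 w1 = col_mx y x.
Proof.
rewrite !mul_block_col => /eq_col_mx[<- <-].
by rewrite addrC [X in col_mx _ X]addrC.
Qed.

Lemma posdef_swap A B C :
  posdef (block_mx A B B^T C) -> posdef (block_mx C B^T B A).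
Proof.
move=> [sM M0]; split.
  by move: sM; rewrite !tr_block_mx trmxK => /eq_block_mx[-> _ _ ->].
move=> v; rewrite -(vsubmxK v) => v0.
have := M0 (col_mx (dsubmx v) (usubmx v)).
rewrite /qform -!mulmxA !mul_block_col !dot_col_mx => M0v.
rewrite addrC (addrC (B *m _)) (addrC (C *m _)); apply: M0v.
apply: contra v0 => /eqP; rewrite -(@col_mx0 _ d m 1) => /eq_col_mx[-> ->].
by rewrite col_mx0.
Qed.

Lemma det_schur A B C : A \in unitmx ->
  \det (block_mx A B B^T C) = \det A * \det (schur A B C).
Proof.
move=> uA.
have -> : block_mx A B B^T C =
    block_mx 1%:M 0 (B^T *m invmx A) 1%:M *m block_mx A B 0 (schur A B C).
  rewrite mulmx_block !(mul1mx, mul0mx, mulmx0, addr0) mulmxKV//.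
  by rewrite /schur addrC subrK.
by rewrite det_mulmx det_lblock det_ublock !det1 !mul1r.
Qed.

(** Elimination of the last block instead of the first; comparing with
    [det_schur] shows that exchanging the blocks preserves the determinant. *)
Lemma det_block_swap A B C : C \in unitmx ->
  \det (block_mx A B B^T C) = \det C * \det (A - B *m invmx C *m B^T).
Proof.
move=> uC.
have -> : block_mx A B B^T C = block_mx 1%:M (B *m invmx C) 0 1%:M *m
    block_mx (A - B *m invmx C *m B^T) 0 B^T C.
  by rewrite mulmx_block !(mul1mx, mul0mx, mulmx0, add0r) mulmxKV// subrK.
by rewrite det_mulmx det_ublock det_lblock !det1 !mul1r mulrC.
Qed.

(** Completing the square: $M w = (x, y)$ is solved by block elimination, with
    $w_2 = S^{-1} (y - B^T A^{-1} x)$ for the Schur complement $S$. *)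
Lemma qform_schur A B C (x : 'cV[R]_d) (y : 'cV[R]_m) :
  posdef (block_mx A B B^T C) ->
  qform (invmx (block_mx A B B^T C)) (col_mx x y) (col_mx x y) =
  qform (invmx A) x x +
  qform (invmx (schur A B C)) (y - B^T *m invmx A *m x) (y - B^T *m invmx A *m x).
Proof.
move=> pM; have uM := posdef_unitmx pM; have pA := posdef_ul pM.
have uA := posdef_unitmx pA; have uS := posdef_unitmx (posdef_schur pM).
set e := y - _; pose w2 := invmx (schur A B C) *m e.
pose w1 := invmx A *m (x - B *m w2).
rewrite (@qform_dot _ _ _ _ (col_mx w1 w2)); [|exact: uM|].
  rewrite dot_col_mx /w1 mulmxBr mulmxBr [X in X + _]mxE [X in _ + X + _]mxE.
  rewrite /qform -mulmxA -addrA; congr (_ + _).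
  rewrite -[e^T *m _ *m e]mulmxA -/w2 /e linearB/= mulmxBl.
  rewrite !trmx_mul trmxK trmx_inv pA.1 !mulmxA !mxE.
  exact: addrC.
rewrite mul_block_col /w1 mulKVmx// subrK; congr col_mx.
have -> : y = B^T *m invmx A *m x + schur A B C *m w2.
  by rewrite mulKVmx// addrC subrK.
by rewrite mulmxA mulmxBr /schur mulmxBl !mulmxA -addrA (addrC (- _)).
Qed.

Lemma qform_block_swap A B C (x : 'cV[R]_d) (y : 'cV[R]_m) :
  posdef (block_mx A B B^T C) ->
  qform (invmx (block_mx A B B^T C)) (col_mx x y) (col_mx x y) =
  qform (invmx (block_mx C B^T B A)) (col_mx y x) (col_mx y x).
Proof.
move=> pM; have uM := posdef_unitmx pM; have uM' := posdef_unitmx (posdef_swap pM).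
pose w := invmx (block_mx A B B^T C) *m col_mx x y.
have Mw : block_mx A B B^T C *m col_mx (usubmx w) (dsubmx w) = col_mx x y.
  by rewrite vsubmxK mulKVmx.
rewrite (qform_dot uM Mw) (qform_dot uM' (block_swap_mul Mw)).
by rewrite !dot_col_mx addrC.
Qed.

End schur.

Lemma posdef_dr (R : realType) d m (A : 'M[R]_d) (B : 'M[R]_(d, m)) (C : 'M[R]_m) :
  posdef (block_mx A B B^T C) -> posdef C.
Proof.
by move=> /posdef_swap; rewrite -[X in block_mx _ _ X _]trmxK => /posdef_ul.
Qed.

Lemma sym_block_mx (R : realType) d m (S : 'M[R]_(d + m)) : S^T = S ->
  S = block_mx (ulsubmx S) (ursubmx S) (ursubmx S)^T (drsubmx S).
Proof.
by move=> symS; rewrite -[LHS]submxK; congr block_mx; rewrite trmx_ursub symS.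
Qed.

(** Elimination of one coordinate at a time. In terms of normal laws this is
    conditioning on the first coordinate, of variance $A$: given it, the others
    have the Schur complement as covariance. *)
Lemma posdef_ind (R : realType) (P : forall n, 'M[R]_n -> Prop) :
  (forall S : 'M[R]_0, P 0 S) ->
  (forall n (A : 'M[R]_1) (B : 'M[R]_(1, n)) (C : 'M[R]_n),
     posdef (block_mx A B B^T C) -> P n (schur A B C) ->
     P (1 + n)%N (block_mx A B B^T C)) ->
  forall n (S : 'M[R]_n), posdef S -> P n S.
Proof.
move=> P0 PS; elim=> [//|n IH] S pS.
have eS := @sym_block_mx R 1 n S pS.1.
have pB : posdef (block_mx (@ulsubmx R 1 n 1 n S) (@ursubmx R 1 n 1 n S)
  (@ursubmx R 1 n 1 n S)^T (@drsubmx R 1 n 1 n S)) by rewrite -eS.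
by have := PS _ _ _ _ pB (IH _ (posdef_schur pB)); rewrite -eS.
Qed.

Lemma posdef1_gt0 (R : realType) (A : 'M[R]_1) : posdef A -> 0 < A ord0 ord0.
Proof.
move=> pA; have := pA.2 1%:M; rewrite /qform trmx1 mul1mx mulmx1; apply.
exact: oner_neq0.
Qed.

Lemma det_posdef (R : realType) n (S : 'M[R]_n) : posdef S -> 0 < \det S.
Proof.
move: n S; apply: posdef_ind => [S|n A B C pM IH]; first by rewrite det_mx00.
have pA := posdef_ul pM.
by rewrite (det_schur _ _ (posdef_unitmx pA)) mulr_gt0// det_mx11 posdef1_gt0.
Qed.

(** * Lebesgue measure on column vectors *)

Section measurability.
Context {R : realType}.

Lemma measurable_usubmx d m :
  measurable_fun setT (usubmx : 'cV[R]_(d + m) -> 'cV[R]_d).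
Proof.
apply/measurable_fun_cVP => i; under eq_fun do rewrite mxE.
exact: measurable_coord.
Qed.

Lemma measurable_dsubmx d m :
  measurable_fun setT (dsubmx : 'cV[R]_(d + m) -> 'cV[R]_m).
Proof.
apply/measurable_fun_cVP => i; under eq_fun do rewrite mxE.
exact: measurable_coord.
Qed.

Lemma measurable_const_mx n : measurable_fun setT (const_mx : R -> 'cV[R]_n).
Proof.
apply/measurable_fun_cVP => i; under eq_fun do rewrite mxE.
exact: measurable_id.
Qed.

Context disp (T : measurableType disp).

Lemma measurable_col_mx d m (f : T -> 'cV[R]_d) (g : T -> 'cV[R]_m) :
  measurable_fun setT f -> measurable_fun setT g ->
  measurable_fun setT (fun t => col_mx (f t) (g t)).
Proof.
move=> /measurable_fun_cVP mf /measurable_fun_cVP mg; apply/measurable_fun_cVP => i.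
case: (split_ordP i) => j ->.
- by under eq_fun do rewrite col_mxEu; exact: mf.
- by under eq_fun do rewrite col_mxEd; exact: mg.
Qed.

Lemma measurable_mulmx n m (K : 'M[R]_(m, n)) (f : T -> 'cV[R]_n) :
  measurable_fun setT f -> measurable_fun setT (fun t => K *m f t).
Proof.
move=> /measurable_fun_cVP mf; apply/measurable_fun_cVP => i.
under eq_fun do rewrite mxE.
by apply: measurable_sum => j; apply: measurable_funM.
Qed.

Lemma measurable_cV_add n (f g : T -> 'cV[R]_n) :
  measurable_fun setT f -> measurable_fun setT g ->
  measurable_fun setT (fun t => f t + g t).
Proof.
move=> /measurable_fun_cVP mf /measurable_fun_cVP mg; apply/measurable_fun_cVP => i.
by under eq_fun do rewrite mxE; exact: measurable_funD.
Qed.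

Lemma measurable_cV_opp n (f : T -> 'cV[R]_n) :
  measurable_fun setT f -> measurable_fun setT (fun t => - f t).
Proof.
move=> /measurable_fun_cVP mf; apply/measurable_fun_cVP => i.
by under eq_fun do rewrite mxE; exact: measurableT_comp.
Qed.

Lemma measurable_qform n (K : 'M[R]_n) (f : T -> 'cV[R]_n) :
  measurable_fun setT f -> measurable_fun setT (fun t => qform K (f t) (f t)).
Proof.
move=> mf; have /measurable_fun_cVP mKf := measurable_mulmx K mf.
move/measurable_fun_cVP : mf => mf.
rewrite /qform; under eq_fun do rewrite -mulmxA mxE.
apply: measurable_sum => j; apply: measurable_funM; last exact: mKf.
by under eq_fun do rewrite mxE; exact: mf.
Qed.

Lemma measurable_forall_coord n (D : set R) (f : T -> 'cV[R]_n) :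
  measurable D -> measurable_fun setT f ->
  measurable [set t | forall i, D (f t i ord0)].
Proof.
move=> mD /measurable_fun_cVP mf.
rewrite (_ : [set t | _] = \bigcap_(i in [set: 'I_n]) [set t | D (f t i ord0)]).
  apply: fin_bigcap_measurable => // i _.
  by rewrite -[X in measurable X]setTI; exact: mf.
by apply/seteqP; split => [t /= + i _|t /= + i]; exact.
Qed.

End measurability.

Section integration.
Context {R : realType}.
Local Notation leb := (@lebesgue_measure R).
Local Notation vol n := (@lebesgue_cV R n).

Lemma measurable_cons_cV n (f : 'cV[R]_n.+1 -> \bar R) :
  measurable_fun setT f ->
  measurable_fun setT (fun p : measurableTypeR R * 'cV[R]_n =>
    f (col_mx (const_mx p.1 : 'cV[R]_1) p.2)).
Proof.
move=> mf; apply: (measurableT_comp mf).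
apply: (@measurable_col_mx R _ _ 1 n).
  exact: (measurableT_comp (@measurable_const_mx R 1)).
exact: measurable_snd.
Qed.

Lemma integral_cVS n (f : 'cV[R]_n.+1 -> \bar R) :
  measurable_fun setT f -> (forall x, 0 <= f x)%E ->
  (\int[vol n.+1]_x f x =
   \int[leb]_t \int[vol n]_v f (col_mx (const_mx t : 'cV[R]_1) v))%E.
Proof.
move=> mf f0.
pose cons (p : measurableTypeR R * 'cV[R]_n) : 'cV[R]_n.+1 :=
  col_mx (const_mx p.1 : 'cV[R]_1) p.2.
have mcons : measurable_fun setT cons.
  apply: (@measurable_col_mx R _ _ 1 n).
    exact: (measurableT_comp (@measurable_const_mx R 1)).
  exact: measurable_snd.
transitivity (\int[pushforward (leb \x vol n)%E cons]_x f x)%E.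
  exact: eq_measure_integral.
rewrite ge0_integral_pushforward// preimage_setT fubini_tonelli1//.
  exact: measurableT_comp.
by move=> x /=; exact: f0.
Qed.

Lemma integral_cV0 (f : 'cV[R]_0 -> \bar R) :
  measurable_fun setT f -> (\int[vol 0]_x f x)%E = f 0.
Proof.
move=> mf; transitivity (\int[\d_(0%R : 'cV[R]_0)]_x f x)%E => //.
by rewrite integral_dirac// diracT mul1e.
Qed.

Lemma integral_cV1 (f : 'cV[R]_1 -> \bar R) :
  measurable_fun setT f -> (forall x, 0 <= f x)%E ->
  (\int[vol 1]_x f x = \int[leb]_t f (const_mx t))%E.
Proof.
move=> mf f0; rewrite integral_cVS//; apply: eq_integral => t _.
rewrite integral_cV0; last by apply: measurableT_comp => //; exact: (@measurable_col_mx R _ _ 1 0).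
congr f.
by apply/matrixP => i j; rewrite (ord1 i) !mxE; case: splitP => // k; rewrite mxE.
Qed.

Lemma measurable_integral_col_mx d m (f : 'cV[R]_(d + m) -> \bar R) :
  measurable_fun setT f -> (forall x, 0 <= f x)%E ->
  measurable_fun setT (fun x : 'cV[R]_d => (\int[vol m]_y f (col_mx x y))%E).
Proof.
move=> mf f0.
apply: (measurable_fun_fubini_tonelli_F
  (fun p : 'cV[R]_d * 'cV[R]_m => f (col_mx p.1 p.2))) => //.
by apply: (measurableT_comp mf); exact: measurable_col_mx.
Qed.

Lemma integral_col_mx d m (f : 'cV[R]_(d + m) -> \bar R) :
  measurable_fun setT f -> (forall x, 0 <= f x)%E ->
  (\int[vol (d + m)]_x f x = \int[vol d]_x \int[vol m]_y f (col_mx x y))%E.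
Proof.
elim: d f => [|d IH] f mf f0.
  rewrite integral_cV0.
    by apply: eq_integral => y _; rewrite col_flat_mx.
  exact: measurable_integral_col_mx.
have mcons (t : R) : measurable_fun setT (fun w : 'cV[R]_(d + m) =>
    f (@col_mx R 1 (d + m) 1 (const_mx t) w)).
  apply: (measurableT_comp mf); exact: (@measurable_col_mx R _ _ 1 (d + m)).
rewrite (@integral_cVS (d + m) f)//.
rewrite (@integral_cVS d (fun x => \int[vol m]_y f (col_mx x y))%E)//; last 2 first.
- exact: measurable_integral_col_mx.
- by move=> x; apply: integral_ge0.
apply: eq_integral => t _; rewrite IH//.
apply: eq_integral => x _; apply: eq_integral => y _; congr f.
have := @col_mxA R 1 d m 1 (const_mx t) x y => /= ->.
exact: castmx_id.
Qed.

End integration.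

Section change_of_variables.
Context {R : realType}.
Local Notation leb := (@lebesgue_measure R).
Local Notation vol n := (@lebesgue_cV R n).

Lemma integral_affine1 (f : R -> \bar R) (a b : R) : a != 0 ->
  measurable_fun setT f -> (forall x, 0 <= f x)%E ->
  (`|a|%:E * \int[leb]_t f (a * t + b)%R = \int[leb]_t f t)%E.
Proof.
move=> a0 mf f0.
pose phi (t : measurableTypeR R) : measurableTypeR R := a * t + b.
have mphi : measurable_fun setT phi by apply: measurable_funD => //; exact: measurable_funM.
apply: (@etrans _ _ (\int[mscale (NngNum (normr_ge0 a)) (pushforward leb phi)]_t f t)%E); last first.
  apply: eq_measure_integral => A mA _; apply/esym/lebesgue_measure_unique => //= _ [[u v]] _ <-.
  rewrite /mscale/= /pushforward.
  have [ap|an] := ltrP 0 a.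
    have -> : phi @^-1` `]u, v]%classic = `](u - b) / a, (v - b) / a]%classic.
      apply/seteqP; split => t /=; rewrite !in_itv/= /phi => /andP[ut tv];
        rewrite ?ltr_pdivrMr ?ler_pdivlMr// in ut tv *; apply/andP; split; lra.
    rewrite !lebesgue_measure_itv/= !lte_fin ltr_pM2r ?invr_gt0// ltrD2r.
    case: ifPn => uv; last by rewrite mule0.
    by rewrite -!EFinD -EFinM gtr0_norm//; congr EFin; field; rewrite gt_eqF.
  have {an}an : a < 0 by rewrite lt_neqAle a0.
  have -> : phi @^-1` `]u, v]%classic = `[(v - b) / a, (u - b) / a[%classic.
    apply/seteqP; split => t /=; rewrite !in_itv/= /phi => /andP[ut tv];
      rewrite ?ltr_ndivlMr ?ler_ndivrMr// in ut tv *; apply/andP; split; lra.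
  rewrite !lebesgue_measure_itv/= !lte_fin ltr_nM2r ?invr_lt0// ltrD2r.
  case: ifPn => uv; last by rewrite mule0.
  by rewrite -!EFinD -EFinM ltr0_norm//; congr EFin; field; rewrite lt_eqF.
rewrite ge0_integral_mscale//; congr (_ * _)%E.
by rewrite ge0_integral_pushforward.
Qed.

(** Diagonal maps act on each coordinate separately, so that the
    one-dimensional formula suffices; translations, reflections and the scaling
    by standard deviations are all of this form. *)
Lemma integral_affine_cV n (f : 'cV[R]_n -> \bar R) (c : 'rV[R]_n) (b : 'cV[R]_n) :
  (forall i, c ord0 i != 0) -> measurable_fun setT f -> (forall x, 0 <= f x)%E ->
  (`|\det (diag_mx c)|%:E * \int[vol n]_x f (diag_mx c *m x + b)%R = \int[vol n]_x f x)%E.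
Proof.
elim: n f c b => [|n IH] f c b c0 mf f0.
  rewrite det_mx00 normr1 mul1e; apply: eq_integral => x _; congr f.
  by apply/matrixP => -[].
pose c1 := @lsubmx R 1 1 n c; pose c2 := @rsubmx R 1 1 n c.
pose b1 := @usubmx R 1 n 1 b; pose b2 := @dsubmx R 1 n 1 b.
have -> : diag_mx c = block_mx (diag_mx c1) 0 0 (diag_mx c2).
  by rewrite -(diag_mx_row c1 c2); congr diag_mx; rewrite hsubmxK.
rewrite (det_ublock (diag_mx c1)) normrM EFinM.
have -> : b = col_mx b1 b2 by rewrite vsubmxK.
pose M1 := diag_mx c1; pose M2 := diag_mx c2.
transitivity (`|\det M1|%:E * (`|\det M2|%:E *
   \int[leb]_t \int[vol n]_v f (col_mx (M1 *m const_mx t + b1)%R (M2 *m v + b2)%R)))%E.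
  rewrite muleA; congr (_ * _)%E.
  rewrite (@integral_cVS R n)//; last first.
    apply: (measurableT_comp mf); apply: measurable_cV_add => //.
    exact: measurable_mulmx.
  apply: eq_integral => t _; apply: eq_integral => v _; congr f.
  rewrite (mul_block_col M1) !mul0mx addr0 add0r.
  exact: (@add_col_mx R 1 n 1).
pose H (t : measurableTypeR R) := (\int[vol n]_v f (col_mx (const_mx t : 'cV[R]_1) v))%E.
have mH : measurable_fun setT H.
  exact: (measurable_fun_fubini_tonelli_F _ (measurable_cons_cV mf)).
have IHt (t : R) : (`|\det M2|%:E *
    \int[vol n]_v f (col_mx (M1 *m const_mx t + b1) (M2 *m v + b2))%R =
    H (c1 ord0 ord0 * t + b1 ord0 ord0)%R)%E.
  rewrite (IH (fun w => f (@col_mx R 1 n 1 (M1 *m const_mx t + b1) w)))//; last 2 first.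
  - by move=> i; rewrite mxE.
  - apply: (measurableT_comp mf); exact: (@measurable_col_mx R _ _ 1 n).
  apply: eq_integral => w _; congr (f (@col_mx R 1 n 1 _ w)).
  apply/matrixP => i j; rewrite !ord1 /M1 mul_diag_mx !mxE.
  by [].
rewrite -ge0_integralZl//; last 2 first.
- apply: (measurable_fun_fubini_tonelli_F (fun p : measurableTypeR R * 'cV[R]_n =>
    f (@col_mx R 1 n 1 (M1 *m const_mx p.1 + b1) (M2 *m p.2 + b2)))) => //.
  apply: (measurableT_comp mf); apply: (@measurable_col_mx R _ _ 1 n).
    apply: measurable_cV_add => //; apply: measurable_mulmx.
    exact: (measurableT_comp (@measurable_const_mx R 1)).
  by apply: measurable_cV_add => //; exact: measurable_mulmx.
- by move=> t _; apply: integral_ge0.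
under eq_integral do rewrite IHt.
rewrite det_mx11 [X in `|X|]mxE eqxx mulr1n integral_affine1//.
- by rewrite integral_cVS.
- by rewrite mxE c0.
- by move=> t; apply: integral_ge0.
Qed.

Lemma lebesgue_cVS n (A : set 'cV[R]_n.+1) (B : set (R * 'cV[R]_n)) :
  (forall t v, A (col_mx (const_mx t : 'cV[R]_1) v) <-> B (t, v)) ->
  vol n.+1 A = (leb \x vol n)%E B.
Proof.
move=> AB; rewrite (_ : B = [set p | A (col_mx (const_mx p.1 : 'cV[R]_1) p.2)])//.
by apply/seteqP; split => -[t v] /= /AB.
Qed.

Lemma lebesgue_cV_hyperplane n (i : 'I_n) (a : R) :
  (vol n [set x : 'cV[R]_n | x i ord0 = a] = 0)%E.
Proof.
elim: n i => [[]//|n IH] i.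
case: (@split_ordP 1 n i) => j ->.
  rewrite (@lebesgue_cVS _ _ ([set a] `*` setT)); last first.
    by move=> t v /=; rewrite (@col_mxEu R 1 n 1) mxE; split => // -[].
  by rewrite product_measure1E// [X in (X * _)%E](lebesgue_measure_set1 a) mul0e.
rewrite (@lebesgue_cVS _ _ (setT `*` [set x : 'cV[R]_n | x j ord0 = a])); last first.
  by move=> t v /=; rewrite (@col_mxEd R 1 n 1); split => // -[].
rewrite product_measure1E//; first by rewrite [X in (_ * X)%E](IH j) mule0.
rewrite -[X in measurable X]setTI.
exact: (@measurable_coord R n j measurableT _ (measurable_set1 a)).
Qed.

Definition orthant n (u : 'cV[R]_n) : set 'cV[R]_n :=
  [set x | forall i, x i ord0 <= u i ord0].

Lemma measurable_orthant n (u : 'cV[R]_n) : measurable (orthant u).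
Proof.
rewrite (_ : orthant u = [set x | forall i, [set` `]-oo, 0%R]] ((x - u) i ord0)]).
  apply: measurable_forall_coord => //.
  by apply: measurable_cV_add => //; exact: measurable_cst.
by apply/seteqP; split => x /= h i; have := h i; rewrite /= !mxE in_itv/= subr_le0.
Qed.

Lemma orthant_col_mx d m (u x : 'cV[R]_d) (v y : 'cV[R]_m) :
  orthant (col_mx u v) (col_mx x y) <-> orthant u x /\ orthant v y.
Proof.
split=> [h|[xu yv] i].
  split=> i; first by have := h (lshift m i); rewrite !col_mxEu.
  by have := h (rshift d i); rewrite !col_mxEd.
by case: (split_ordP i) => j ->; rewrite ?col_mxEu ?col_mxEd.
Qed.

Lemma lebesgue_cV_orthant_gt0 n (u : 'cV[R]_n) : (0 < vol n (orthant u))%E.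
Proof.
elim: n u => [|n IH] u.
  by rewrite [X in (_ < X)%E]/= diracE mem_set//= => -[].
pose a := @usubmx R 1 n 1 u ord0 ord0.
rewrite (@lebesgue_cVS _ _ ([set` `]-oo, a]] `*` orthant (@dsubmx R 1 n 1 u))); last first.
  move=> t v /=; rewrite in_itv/=.
  have -> : orthant u (col_mx (const_mx t : 'cV[R]_1) v) <->
      orthant (@usubmx R 1 n 1 u) (const_mx t) /\ orthant (@dsubmx R 1 n 1 u) v.
    by rewrite -{1}(@vsubmxK R 1 n 1 u); exact: (@orthant_col_mx 1 n).
  suff -> : orthant (@usubmx R 1 n 1 u) (const_mx t) <-> t <= a by [].
  by split=> [/(_ ord0)|ta i]; rewrite mxE ?(ord1 i).
rewrite product_measure1E//; last exact: measurable_orthant.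
rewrite mule_gt0//; last exact: IH.
by rewrite [X in (_ < X)%E](lebesgue_measure_itv `]-oo, a]) /= ltNyr/= ltry.
Qed.

End change_of_variables.

(** * The Prekopa-Leindler inequality on the line *)

Section prekopa_leindler.
Context {R : realType}.
Local Notation leb := (@lebesgue_measure R).

Lemma lebesgue_measure_affine (A : set R) (a b : R) : a != 0 -> measurable A ->
  (`|a|%:E * leb [set t | A (a * t + b)%R] = leb A)%E.
Proof.
move=> a0 mA.
have mpre : measurable [set t : R | A (a * t + b)].
  rewrite -[X in measurable X]setTI.
  suff : measurable_fun setT (fun t : R => a * t + b) by exact.
  by apply: measurable_funD => //; exact: measurable_funM.
have mI : measurable_fun setT (fun t : R => (\1_A t)%:E : \bar R).
  by apply/measurable_EFinP; exact: measurable_indic.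
have ind D : measurable D -> leb D = (\int[leb]_t (\1_D t)%:E)%E.
  by move=> mD; rewrite integral_indic// setIT.
rewrite (ind _ mA) (ind _ mpre) -(integral_affine1 b a0 mI)//.
Qed.

(** Lebesgue measure is inner regular, so a superadditivity bound may be checked
    on compact subsets; these can be taken nonempty. *)
Lemma lebesgue_inner_leD (A : set R) (y z : \bar R) : measurable A -> A !=set0 ->
  (0 <= y)%E ->
  (forall K, compact K -> K `<=` A -> K !=set0 -> (leb K + y <= z)%E) ->
  (leb A + y <= z)%E.
Proof.
move=> mA [a Aa] y0 Kz.
have [->|zy] := eqVneq z +oo%E; first by rewrite leey.
have yz : (y <= z)%E.
  have := Kz [set a] (@compact_set1 _ a).
  rewrite [X in (X + _)%E](lebesgue_measure_set1 a) add0e; apply; last by exists a.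
  by move=> _ ->.
have yfin : y \is a fin_num.
  by rewrite ge0_fin_numE// (le_lt_trans yz)// ltey.
rewrite -leeBrDr// lebesgue_regularity_inner_sup//.
apply: ge_ereal_sup => _ [K [cK KA] <-].
rewrite leeBrDr//.
apply: (@le_trans _ _ (leb (K `|` [set a]) + y)%E).
  rewrite leeD2r// le_measure// ?inE//; first exact: compact_measurable.
  by apply: measurableU => //; exact: compact_measurable.
apply: Kz; first by apply: compactU => //; exact: compact_set1.
  by move=> x [/KA//|->].
by exists a; right.
Qed.

(** The one-dimensional Brunn-Minkowski inequality. For compact $K$ and $L$, the
    translates $K + \min L$ and $\max K + L$ lie in $K + L$ and meet only in
    the point $\max K + \min L$. *)
Lemma brunn_minkowski1 (A B C : set R) :
  measurable A -> measurable B -> measurable C -> A !=set0 -> B !=set0 ->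
  (forall x y, A x -> B y -> C (x + y)) -> (leb A + leb B <= leb C)%E.
Proof.
move=> mA mB mC A0 B0 ABC.
apply: lebesgue_inner_leD => // K cK KA K0.
rewrite addeC; apply: lebesgue_inner_leD => // L cL LB L0.
have mK := compact_measurable cK; have mL := compact_measurable cL.
have cid (D : set R) : {within D, continuous (@idfun R)}.
  by apply: continuous_subspaceT => x; exact: cvg_id.
have [a /set_mem Ka maxa] := compact_EVT_max K0 cK (cid K).
have [b /set_mem Lb minb] := compact_EVT_min L0 cL (cid L).
have trans (D : set R) (e : R) : measurable D ->
    measurable [set t | D (t + e)] /\ leb [set t | D (t + e)] = leb D.
  move=> mD; split.
    rewrite -[X in measurable X]setTI.
    suff : measurable_fun setT (fun t : R => t + e) by exact.
    exact: measurable_funD.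
  rewrite -(@lebesgue_measure_affine D 1 e)// normr1 mul1e.
  by congr (leb _); apply/seteqP; split => t /=; rewrite mul1r.
have [mK' <-] := trans K (- b) mK; have [mL' <-] := trans L (- a) mL.
set c := a + b.
have mlo : measurable (C `&` `]-oo, c[%classic) by apply: measurableI.
have mhi : measurable (C `&` `[c, +oo[%classic) by apply: measurableI.
have -> : C = (C `&` `[c, +oo[%classic) `|` (C `&` `]-oo, c[%classic).
  rewrite -setIUr; apply/esym/setIidPl => x _ /=; rewrite !in_itv/= andbT.
  by case: (leP c x); [left|right].
rewrite measureU//; last first.
  apply/seteqP; split => // x [[_ /=] + [_ /=]]; rewrite !in_itv/= andbT.
  by move=> cx; rewrite ltNge cx.
apply: leeD.
  apply: le_measure; rewrite ?inE// => t /= Lt; split.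
    by rewrite -(subrK a t) addrC; apply: ABC; [exact: KA|exact: LB].
  rewrite /= in_itv/= andbT /c; have := minb _ (mem_set Lt); rewrite /idfun; lra.
apply: (@le_trans _ _ (leb ((C `&` `]-oo, c[%classic) `|` [set c]))).
  apply: le_measure; rewrite ?inE//; first exact: measurableU.
  move=> t /= Kt; have [<-|tc] := eqVneq c t; [by right|left]; split.
    by rewrite -(subrK b t); apply: ABC; [exact: KA|exact: LB].
  rewrite /= in_itv/= lt_neqAle eq_sym tc /c/=.
  have := maxa _ (mem_set Kt); rewrite /idfun; lra.
apply: le_trans; first exact: (measureU2 leb mlo (measurable_set1 c)).
by rewrite [X in (_ + X)%E](lebesgue_measure_set1 c) adde0.
Qed.

Lemma brunn_minkowski1_conv (A B C : set R) (l : R) :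
  measurable A -> measurable B -> measurable C -> A !=set0 -> B !=set0 ->
  0 < l -> l < 1 ->
  (forall x y, A x -> B y -> C (l * x + (1 - l) * y)) ->
  (l%:E * leb A + (1 - l)%:E * leb B <= leb C)%E.
Proof.
move=> mA mB mC [x Ax] [y By] l0 l1 ABC.
have dil (D : set R) (e : R) : measurable D -> 0 < e ->
    measurable [set t | D (e^-1 * t)] /\
    leb [set t | D (e^-1 * t)] = (e%:E * leb D)%E.
  move=> mD e0; split.
    rewrite -[X in measurable X]setTI.
    suff : measurable_fun setT (fun t : R => e^-1 * t) by exact.
    exact: measurable_funM.
  rewrite -(@lebesgue_measure_affine D e^-1 0)//; last by rewrite invr_neq0// gt_eqF.
  rewrite muleA gtr0_norm ?invr_gt0// -EFinM divff ?gt_eqF// mul1e.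
  by congr (leb _); apply/seteqP; split => t /=; rewrite addr0.
have l1' : 0 < 1 - l by rewrite subr_gt0.
have [mA' <-] := dil A l mA l0; have [mB' <-] := dil B (1 - l) mB l1'.
apply: brunn_minkowski1 => //.
- by exists (l * x) => /=; rewrite mulKf// gt_eqF.
- by exists ((1 - l) * y) => /=; rewrite mulKf// gt_eqF.
- move=> s t /= As Bt; have := ABC _ _ As Bt.
  by rewrite !mulVKf// gt_eqF.
Qed.

Lemma layer_cake (f : R -> R) : measurable_fun setT f -> (forall x, 0 <= f x) ->
  measurable_fun setT (fun t : R => leb [set x | t < f x]) /\
  (\int[leb]_x (f x)%:E = \int[leb]_(t in `[0%R, +oo[) leb [set x | (t < f x)%R])%E.
Proof.
move=> mf f0.
pose E := [set p : measurableTypeR R * measurableTypeR R | p.1 < f p.2].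
have mE : measurable E.
  have : measurable_fun setT (fun p : measurableTypeR R * measurableTypeR R => p.1 < f p.2).
    by apply: measurable_fun_ltr => //; exact: (measurableT_comp mf measurable_snd).
  by move=> /(_ measurableT [set true]); rewrite setTI; exact.
pose D : set R := `[0%R, +oo[%classic.
have mlev t : measurable [set x : R | t < f x].
  rewrite -[X in measurable X]setTI.
  rewrite (_ : [set x | _] = f @^-1` `]t, +oo[%classic); first exact: mf.
  by apply/seteqP; split => x /=; rewrite in_itv/= andbT.
have mI : measurable_fun setT (fun p : measurableTypeR R * measurableTypeR R =>
    (\1_D p.1 * \1_E p)%:E : \bar R).
  apply/measurable_EFinP; apply: measurable_funM; last exact: (measurable_indic mE).
  have mD : measurable_fun setT (\1_D : measurableTypeR R -> R).
    by apply: measurable_indic; exact: measurable_itv.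
  exact: (measurableT_comp mD measurable_fst).
have lev t : leb [set x | t < f x] = (\int[leb]_x (\1_E (t, x))%:E)%E.
  transitivity (\int[leb]_x (\1_[set x | (t < f x)%R] x)%:E)%E.
    by rewrite integral_indic ?setIT//; exact: mlev.
  apply: eq_integral => x _; congr EFin; rewrite !indicE; congr (nat_of_bool _)%:R.
split.
  under eq_fun do rewrite lev.
  apply: (measurable_fun_fubini_tonelli_F (fun p : measurableTypeR R * measurableTypeR R =>
    (\1_E p)%:E : \bar R)) => //.
  by apply/measurable_EFinP; exact: (measurable_indic mE).
transitivity (\int[leb]_x \int[leb]_t (\1_D t * \1_E (t, x))%:E)%E.
  apply: eq_integral => x _.
  transitivity (\int[leb]_t (\1_(`[0%R, f x[%classic : set R) t)%:E)%E.
    rewrite integral_indic// setIT [RHS](lebesgue_measure_itv `[0, f x[) /= lte_fin.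
    by case: ltP => fx0; [rewrite oppr0 adde0|congr EFin; apply/le_anti; rewrite f0 fx0].
  apply: eq_integral => t _; congr EFin; rewrite !indicE -natrM mulnb.
  congr (nat_of_bool _)%:R.
  by apply/idP/andP; rewrite !inE /E /D /= !in_itv/= andbT => /andP.
transitivity (\int[leb]_t \int[leb]_x (\1_D t * \1_E (t, x))%:E)%E.
  by apply/esym/(fubini_tonelli _ mI) => p; rewrite lee_fin mulr_ge0.
rewrite [RHS]integral_mkcond; apply: eq_integral => t _ /=.
rewrite patchE lev; case: ifPn => tD.
  by apply: eq_integral => x _; rewrite indicE tD mul1r.
by apply: integral0_eq => x _; rewrite indicE (negbTE tD) mul0r.
Qed.

Lemma geom_mean_ge_min (a b l : R) : 0 <= a -> 0 <= b -> 0 <= l -> l <= 1 ->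
  Num.min a b <= a `^ l * b `^ (1 - l).
Proof.
move=> a0 b0 l0 l1; set m := Num.min a b.
have m0 : 0 <= m by rewrite le_min a0.
have ma : m <= a by rewrite ge_min lexx.
have mb : m <= b by rewrite ge_min lexx orbT.
rewrite -[leLHS]powRr1// [in leLHS](_ : 1 = l + (1 - l)); last by rewrite addrC subrK.
rewrite powRD; last by rewrite addrC subrK oner_eq0.
by rewrite ler_pM ?powR_ge0// ge0_ler_powR ?nnegrE ?subr_ge0.
Qed.

Lemma geom_mean_le (a b l : R) : 0 <= a -> 0 <= b -> 0 < l -> l < 1 ->
  a `^ l * b `^ (1 - l) <= l * a + (1 - l) * b.
Proof.
move=> a0 b0 l0 l1; have l1' : 0 < 1 - l by rewrite subr_gt0.
have := @conjugate_powR R (a `^ l) (b `^ (1 - l)) l^-1 (1 - l)^-1.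
rewrite !invrK -!powRrM !mulfV ?gt_eqF// !powRr1// mulrC (mulrC l) (mulrC (1 - l)).
by rewrite (mulrC (b `^ _)) => ->//; rewrite ?powR_ge0 ?invr_gt0// addrC subrK.
Qed.

(** When both functions have supremum 1 the level sets at each height $t < 1$
    are nonempty, so that Brunn-Minkowski applies to all of them; from height 1 on
    those of $f$ and $g$ are empty. Integrating over $t$ gives the claim. *)
Lemma prekopa_leindler_normalized (f g h : R -> R) (l : R) :
  measurable_fun setT f -> measurable_fun setT g -> measurable_fun setT h ->
  (forall x, 0 <= f x) -> (forall x, 0 <= g x) -> (forall x, 0 <= h x) ->
  (forall x, f x <= 1) -> (forall x, g x <= 1) ->
  (forall t, t < 1 -> exists x, t < f x) ->
  (forall t, t < 1 -> exists x, t < g x) ->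
  0 < l -> l < 1 ->
  (forall x y, Num.min (f x) (g y) <= h (l * x + (1 - l) * y)) ->
  (l%:E * \int[leb]_x (f x)%:E + (1 - l)%:E * \int[leb]_x (g x)%:E <=
   \int[leb]_x (h x)%:E)%E.
Proof.
move=> mf mg mh f0 g0 h0 f1 g1 f1' g1' l0 l1 fgh.
have l1' : 0 < 1 - l by rewrite subr_gt0.
have [mF ->] := layer_cake mf f0; have [mG ->] := layer_cake mg g0.
have [mH ->] := layer_cake mh h0.
have [l0W l1W] := (ltW l0, ltW l1').
rewrite -!ge0_integralZl//; [|exact: measurable_funTS|exact: measurable_funTS].
rewrite -ge0_integralD//; last 4 first.
- by move=> t _; rewrite mule_ge0// lee_fin.
- by apply: measurable_funeM; exact: measurable_funTS.
- by move=> t _; rewrite mule_ge0// lee_fin.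
- by apply: measurable_funeM; exact: measurable_funTS.
apply: ge0_le_integral => //.
- by move=> t _; rewrite adde_ge0// mule_ge0// lee_fin.
- by apply: emeasurable_funD; apply: measurable_funeM; exact: measurable_funTS.
- exact: measurable_funTS.
have mlev (k : R -> R) (t : R) : measurable_fun setT k -> measurable [set x | t < k x].
  move=> mk; rewrite -[X in measurable X]setTI.
  rewrite (_ : [set x | _] = k @^-1` `]t, +oo[%classic); first exact: mk.
  by apply/seteqP; split => x /=; rewrite in_itv/= andbT.
move=> t; rewrite /= in_itv/= andbT => t0.
have [t1|t1] := ltP t 1.
  apply: brunn_minkowski1_conv => //; try exact: mlev; [exact: f1'|exact: g1'|].
  by move=> x y /= fx gy; rewrite (lt_le_trans _ (fgh x y))// lt_min fx.
have empty (k : R -> R) : (forall x, k x <= 1) -> [set x | t < k x] = set0.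
  move=> k1; apply/seteqP; split => // x /=.
  by rewrite ltNge (le_trans (k1 x) t1).
by rewrite (empty f)// (empty g)// measure0 !mule0 adde0.
Qed.

(** Dividing $f$ and $g$ by their suprema $A$ and $B$, and $h$ by
    $A^l B^{1 - l}$, gives the normalised case. Its conclusion is stronger, as
    the arithmetic mean of the integrals dominates the geometric one. A zero
    supremum makes the left-hand side vanish. *)
Lemma prekopa_leindler (f g h : R -> R) (F G H l M : R) :
  measurable_fun setT f -> measurable_fun setT g -> measurable_fun setT h ->
  (forall x, 0 <= f x) -> (forall x, 0 <= g x) -> (forall x, 0 <= h x) ->
  (forall x, f x <= M) -> (forall x, g x <= M) ->
  (\int[leb]_x (f x)%:E)%E = F%:E -> (\int[leb]_x (g x)%:E)%E = G%:E ->
  (\int[leb]_x (h x)%:E)%E = H%:E ->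
  0 < l -> l < 1 ->
  (forall x y, f x `^ l * g y `^ (1 - l) <= h (l * x + (1 - l) * y)) ->
  F `^ l * G `^ (1 - l) <= H.
Proof.
move=> mf mg mh f0 g0 h0 fM gM FE GE HE l0 l1 fgh.
have l1' : 0 < 1 - l by rewrite subr_gt0.
have H0 : 0 <= H by rewrite -lee_fin -HE; apply: integral_ge0 => x _; rewrite lee_fin.
have sup_gt0 (k : R -> R) (K : R) : (forall x, 0 <= k x) -> (forall x, k x <= M) ->
    (\int[leb]_x (k x)%:E)%E = K%:E -> K = 0 \/ exists s, [/\ 0 < s,
      forall x, k x <= s & forall t, t < s -> exists x, t < k x].
  move=> k0 kM KE.
  have hs : has_sup (range k).
    by split; [exists (k 0); exists 0|exists M => _ [x _ <-]].
  have ks x : k x <= sup (range k) by apply: sup_upper_bound => //; exists x.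
  have [sk0|sk0] := leP (sup (range k)) 0; [left|right].
    apply: EFin_inj; rewrite -KE; apply: integral0_eq => x _.
    by congr EFin; apply/le_anti; rewrite k0 (le_trans (ks x)).
  exists (sup (range k)); split => // t ts.
  have [_ [x _ <-]] := sup_gt hs.1 ts; by exists x.
have [->|[A [A0 fA A']]] := sup_gt0 f F f0 fM FE.
  by rewrite powR0 ?gt_eqF// mul0r.
have [->|[B [B0 gB B']]] := sup_gt0 g G g0 gM GE.
  by rewrite (powR0 (x := 1 - l)) ?gt_eqF// mulr0.
pose C := A `^ l * B `^ (1 - l).
have C0 : 0 < C by rewrite mulr_gt0// powR_gt0.
have F0 : 0 <= F by rewrite -lee_fin -FE; apply: integral_ge0 => x _; rewrite lee_fin.
have G0 : 0 <= G by rewrite -lee_fin -GE; apply: integral_ge0 => x _; rewrite lee_fin.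
have scale (k : R -> R) (K s : R) : measurable_fun setT k -> (forall x, 0 <= k x) ->
    0 < s -> (\int[leb]_x (k x)%:E)%E = K%:E ->
    (\int[leb]_x (s^-1 * k x)%:E)%E = (s^-1 * K)%:E.
  move=> mk k0 s0 KE; under eq_integral do rewrite EFinM.
  rewrite ge0_integralZl//; first by rewrite KE.
  - exact/measurable_EFinP.
  - by move=> x _; rewrite lee_fin.
  - by rewrite lee_fin invr_ge0 ltW.
have mid (a b : R) : 0 <= a -> 0 <= b -> (A^-1 * a) `^ l * (B^-1 * b) `^ (1 - l) =
    C^-1 * (a `^ l * b `^ (1 - l)).
  have [iA0 iB0] : 0 <= A^-1 /\ 0 <= B^-1 by rewrite !invr_ge0 !ltW.
  move=> a0 b0; rewrite !powRM//.
  rewrite -(powR_inv1 (ltW A0)) -(powR_inv1 (ltW B0)) -!powRrM !mulN1r !powRN.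
  by rewrite /C invfM; ring.
have := @prekopa_leindler_normalized (fun x => A^-1 * f x) (fun x => B^-1 * g x)
  (fun x => C^-1 * h x) l.
rewrite (scale f F)// (scale g G)// (scale h H)// -!EFinM -EFinD lee_fin => main.
have : (A^-1 * F) `^ l * (B^-1 * G) `^ (1 - l) <= C^-1 * H.
  apply: (le_trans (geom_mean_le _ _ l0 l1)).
  - by rewrite mulr_ge0// invr_ge0 ltW.
  - by rewrite mulr_ge0// invr_ge0 ltW.
  apply: main => //.
  - exact: measurable_funM.
  - exact: measurable_funM.
  - exact: measurable_funM.
  - by move=> x; rewrite mulr_ge0// invr_ge0 ltW.
  - by move=> x; rewrite mulr_ge0// invr_ge0 ltW.
  - by move=> x; rewrite mulr_ge0// invr_ge0 ltW.
  - by move=> x; rewrite ler_pdivrMl// mulr1.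
  - by move=> x; rewrite ler_pdivrMl// mulr1.
  - move=> t t1; have [|x tx] := A' (A * t); first by rewrite gtr_pMr.
    by exists x; rewrite ltr_pdivlMl.
  - move=> t t1; have [|x tx] := B' (B * t); first by rewrite gtr_pMr.
    by exists x; rewrite ltr_pdivlMl.
  move=> x y; rewrite (le_trans (geom_mean_ge_min _ _ (ltW l0) (ltW l1)))//.
  - by rewrite mulr_ge0// invr_ge0 ltW.
  - by rewrite mulr_ge0// invr_ge0 ltW.
  by rewrite mid// ler_pM2l ?invr_gt0.
by rewrite mid// ler_pM2l ?invr_gt0.
Qed.

End prekopa_leindler.

(** * The multivariate normal law *)

Section mvn.
Context {R : realType}.
Local Notation leb := (@lebesgue_measure R).
Local Notation vol n := (@lebesgue_cV R n).

Section density.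
Context {n : nat}.
Implicit Types (S : 'M[R]_n).

Lemma mvn_pdf_ge0 S x : 0 <= mvn_pdf S x.
Proof. by rewrite mulr_ge0// ?expR_ge0// invr_ge0. Qed.

Lemma mvn_normalizer_gt0 S : posdef S -> 0 < (2 * pi) ^+ n * \det S.
Proof. by move=> pS; rewrite mulr_gt0// ?det_posdef// exprn_gt0// mulr_gt0// pi_gt0. Qed.

Lemma mvn_pdf_gt0 S x : posdef S -> 0 < mvn_pdf S x.
Proof.
by move=> pS; rewrite mulr_gt0// ?expR_gt0// invr_gt0 sqrtr_gt0 mvn_normalizer_gt0.
Qed.

Lemma mvn_pdf_le S x : posdef S ->
  mvn_pdf S x <= (Num.sqrt ((2 * pi) ^+ n * \det S))^-1.
Proof.
move=> pS; rewrite ler_piMr ?invr_ge0// -expR0 ler_expR mulNr oppr_le0.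
by rewrite divr_ge0// (posdef_ge0 _ (posdef_inv pS)).
Qed.

Lemma mvn_pdfN S x : mvn_pdf S (- x) = mvn_pdf S x.
Proof. by rewrite /mvn_pdf -!/(qform _ _ _) qformNN. Qed.

Lemma measurable_mvn_pdf S : measurable_fun setT (mvn_pdf S).
Proof.
apply: measurable_funM => //; apply: measurableT_comp => //.
apply: measurable_funM => //; apply: measurableT_comp => //.
exact: (measurable_qform (invmx S) (@measurable_id _ _ _)).
Qed.

Lemma measurable_mvn_pdf_shift S (b : 'cV[R]_n) :
  measurable_fun setT (fun x : 'cV[R]_n => mvn_pdf S (x - b)).
Proof.
apply: (measurableT_comp (measurable_mvn_pdf S)).
by apply: measurable_cV_add.
Qed.

Lemma integral_shift (f : 'cV[R]_n -> \bar R) (b : 'cV[R]_n) :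
  measurable_fun setT f -> (forall x, 0 <= f x)%E ->
  (\int[vol n]_x f (x + b)%R = \int[vol n]_x f x)%E.
Proof.
move=> mf f0; rewrite -[RHS](@integral_affine_cV _ _ _ (const_mx 1) b)//.
  rewrite diag_const_mx det1 normr1 mul1e.
  by apply: eq_integral => x _; rewrite mul1mx.
by move=> i; rewrite mxE oner_eq0.
Qed.

Lemma integral_reflect (f : 'cV[R]_n -> \bar R) (b : 'cV[R]_n) :
  measurable_fun setT f -> (forall x, 0 <= f x)%E ->
  (\int[vol n]_x f (b - x)%R = \int[vol n]_x f x)%E.
Proof.
move=> mf f0; rewrite -[RHS](@integral_affine_cV _ _ _ (const_mx (-1)) b)//.
  rewrite diag_const_mx det_scalar normrX normrN1 expr1n mul1e.
  by apply: eq_integral => x _; rewrite mul_scalar_mx scaleN1r addrC.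
by move=> i; rewrite mxE oppr_eq0 oner_eq0.
Qed.

End density.

(** The joint density is the marginal density of the first block times the
    density of the second block conditional on the first. *)
Lemma mvn_pdf_schur d m (A : 'M[R]_d) (B : 'M[R]_(d, m)) (C : 'M[R]_m) x y :
  posdef (block_mx A B B^T C) ->
  mvn_pdf (block_mx A B B^T C) (col_mx x y) =
  mvn_pdf A x * mvn_pdf (schur A B C) (y - B^T *m invmx A *m x).
Proof.
move=> pM; have pA := posdef_ul pM.
rewrite /mvn_pdf -!/(qform _ _ _) qform_schur// (det_schur _ _ (posdef_unitmx pA)).
rewrite mulrACA -expRD -invfM -sqrtrM ?ltW ?mvn_normalizer_gt0//.
congr (_^-1 * expR _); last by rewrite opprD mulrDl.
by congr Num.sqrt; rewrite exprD mulrACA.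
Qed.

Lemma mvn_pdf_block_swap d m (A : 'M[R]_d) (B : 'M[R]_(d, m)) (C : 'M[R]_m) x y :
  posdef (block_mx A B B^T C) ->
  mvn_pdf (block_mx A B B^T C) (col_mx x y) =
  mvn_pdf (block_mx C B^T B A) (col_mx y x).
Proof.
move=> pM; have uC := posdef_unitmx (posdef_dr pM).
rewrite /mvn_pdf -!/(qform _ _ _) qform_block_swap// det_block_swap//.
have -> : \det (block_mx C B^T B A) = \det C * \det (A - B *m invmx C *m B^T).
  by have := det_schur B^T A uC; rewrite /schur trmxK.
by rewrite addnC.
Qed.

Lemma mvn_pdf1E (A : 'M[R]_1) t : posdef A ->
  mvn_pdf A (const_mx t) = normal_pdf 0 (Num.sqrt (A ord0 ord0)) t.
Proof.
move=> pA; have a0 := posdef1_gt0 pA.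
have sa0 : Num.sqrt (A ord0 ord0) != 0 by rewrite gt_eqF// sqrtr_gt0.
rewrite normal_pdfE// /mvn_pdf /normal_peak /normal_fun sqr_sqrtr ?ltW//.
set a := A ord0 ord0 in a0 sa0 *.
have -> : invmx A = (a^-1)%:M by rewrite [A]mx11_scalar invmx_scalar.
rewrite mul_mx_scalar -scalemxAl mxE mxE big_ord1 !mxE det_mx11 -/a expr1 subr0.
by congr (_^-1 * expR _); [congr Num.sqrt; ring|field; rewrite gt_eqF].
Qed.

Lemma integral_mvn_pdf n (S : 'M[R]_n) : posdef S ->
  (\int[vol n]_x (mvn_pdf S x)%:E = 1)%E.
Proof.
move: n S; apply: posdef_ind => [S|n A B C pM IH].
  rewrite integral_cV0; last by apply/measurable_EFinP; exact: measurable_mvn_pdf.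
  by rewrite /mvn_pdf det_mx00 expr0 mul1r sqrtr1 invr1 mul1r mulmx0 mxE oppr0 mul0r expR0.
have pA := posdef_ul pM.
rewrite (@integral_col_mx R 1 n); last 2 first.
- by apply/measurable_EFinP; exact: measurable_mvn_pdf.
- by move=> x; rewrite lee_fin mvn_pdf_ge0.
transitivity (\int[vol 1]_x (mvn_pdf A x)%:E)%E.
  apply: eq_integral => x _.
  under eq_integral do rewrite mvn_pdf_schur// EFinM.
  rewrite ge0_integralZl//; last 3 first.
  - by apply/measurable_EFinP; exact: measurable_mvn_pdf_shift.
  - by move=> y _; rewrite lee_fin mvn_pdf_ge0.
  - by rewrite lee_fin mvn_pdf_ge0.
  rewrite (@integral_shift _ (fun y => (mvn_pdf (schur A B C) y)%:E)) ?IH ?mule1//.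
  - by apply/measurable_EFinP; exact: measurable_mvn_pdf.
  - by move=> y; rewrite lee_fin mvn_pdf_ge0.
rewrite integral_cV1; last 2 first.
- by apply/measurable_EFinP; exact: measurable_mvn_pdf.
- by move=> x; rewrite lee_fin mvn_pdf_ge0.
under eq_integral do rewrite mvn_pdf1E//.
exact: integral_normal_pdf.
Qed.

Section distribution_function.
Context {n : nat}.
Implicit Types (S : 'M[R]_n) (u : 'cV[R]_n).

Lemma measurable_mvn_pdf_orthant S u :
  measurable_fun setT (fun x => mvn_pdf S x * \1_(orthant u) x).
Proof.
apply: measurable_funM; first exact: measurable_mvn_pdf.
by apply: measurable_indic; exact: measurable_orthant.
Qed.

Lemma mvn_probE S (A : set 'cV[R]_n) :
  mvn_prob S A = (\int[vol n]_x (mvn_pdf S x * \1_A x)%:E)%E.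
Proof.
rewrite /mvn_prob integral_mkcond; apply: eq_integral => x _.
by rewrite patchE indicE; case: ifPn => _; rewrite ?mulr1 ?mulr0.
Qed.

Lemma mvn_prob_ge0 S (A : set 'cV[R]_n) : (0 <= mvn_prob S A)%E.
Proof. by apply: integral_ge0 => x _; rewrite lee_fin mvn_pdf_ge0. Qed.

Lemma mvn_prob_fin_num S (A : set 'cV[R]_n) : posdef S -> measurable A ->
  mvn_prob S A \is a fin_num.
Proof.
move=> pS mA; rewrite ge0_fin_numE ?mvn_prob_ge0//.
rewrite (@le_lt_trans _ _ 1%E) ?ltry// -(integral_mvn_pdf pS).
apply: ge0_subset_integral => //.
- by apply/measurable_EFinP; exact: measurable_mvn_pdf.
- by move=> x _; rewrite lee_fin mvn_pdf_ge0.
Qed.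

Lemma mvn_cdfE S u : posdef S -> (mvn_cdf S u)%:E = mvn_prob S (orthant u).
Proof. by move=> pS; rewrite fineK// mvn_prob_fin_num//; exact: measurable_orthant. Qed.

Lemma mvn_cdf_ge0 S u : 0 <= mvn_cdf S u.
Proof. exact/fine_ge0/mvn_prob_ge0. Qed.

Lemma mvn_cdf_le1 S u : posdef S -> mvn_cdf S u <= 1.
Proof.
move=> pS; rewrite -lee_fin mvn_cdfE// -(integral_mvn_pdf pS).
apply: ge0_subset_integral => //.
- exact: measurable_orthant.
- by apply/measurable_EFinP; exact: measurable_mvn_pdf.
- by move=> x _; rewrite lee_fin mvn_pdf_ge0.
Qed.

(** A positive density has a positive integral over the orthant, which is not a
    null set. *)
Lemma mvn_cdf_gt0 S u : posdef S -> 0 < mvn_cdf S u.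
Proof.
move=> pS; rewrite lt_neqAle mvn_cdf_ge0 andbT; apply/eqP => cdf0.
have int0 : (\int[vol n]_(x in orthant u) (mvn_pdf S x)%:E = 0)%E.
  by rewrite -[LHS]/(mvn_prob S (orthant u)) -mvn_cdfE// -cdf0.
have := lebesgue_cV_orthant_gt0 u.
suff -> : vol n (orthant u) = 0%E by rewrite ltxx.
have mD : measurable (orthant u) by exact: measurable_orthant.
have mf : measurable_fun (orthant u) (fun x => (mvn_pdf S x)%:E).
  by apply/measurable_funTS/measurable_EFinP; exact: measurable_mvn_pdf.
have [N [mN N0 DN]] : ae_eq (vol n) (orthant u) (fun x => (mvn_pdf S x)%:E) (cst 0%E).
  apply/ae_eq_integral_abs => //; rewrite -int0; apply: eq_integral => x _.
  by rewrite gee0_abs// lee_fin mvn_pdf_ge0.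
apply: (subset_measure0 mD mN _ N0) => x Dx; apply: DN => /= /(_ Dx)[] /eqP.
by rewrite gt_eqF// mvn_pdf_gt0.
Qed.

Lemma measurable_mvn_cdf S : posdef S -> measurable_fun setT (mvn_cdf S).
Proof.
move=> pS; apply/measurable_EFinP.
rewrite [X in measurable_fun _ X](_ : _ = fun u =>
  (\int[vol n]_x (mvn_pdf S x * \1_(orthant u) x)%:E)%E); last first.
  by apply/funext => u /=; rewrite mvn_cdfE// mvn_probE.
pose E := [set p : 'cV[R]_n * 'cV[R]_n | orthant p.1 p.2].
have mE : measurable E.
  rewrite (_ : E = [set p : 'cV[R]_n * 'cV[R]_n |
      forall i, [set` `]-oo, 0%R]] ((p.2 - p.1) i ord0)]).
    apply: measurable_forall_coord => //; apply: measurable_cV_add => //.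
    exact: measurable_cV_opp.
  by apply/seteqP; split => p /= h i; have := h i; rewrite /= !mxE in_itv/= subr_le0.
have mF : measurable_fun setT (fun p : 'cV[R]_n * 'cV[R]_n =>
    (mvn_pdf S p.2 * \1_E p)%:E : \bar R).
  apply/measurable_EFinP/measurable_funM; last exact: (measurable_indic mE).
  exact: (measurableT_comp (measurable_mvn_pdf S) measurable_snd).
apply: (eq_measurable_fun _ _ (measurable_fun_fubini_tonelli_F _ mF _)).
  move=> u _; apply: eq_integral => x _; congr (_ * _)%:E.
by move=> p; rewrite lee_fin mulr_ge0// mvn_pdf_ge0.
Qed.

End distribution_function.

(** In the inner integral the substitution $y \mapsto y - B^T A^{-1} x$ recentres
    the conditional law, which moves the bound $v$ by the same amount. *)
Lemma mvn_cdf_col_mx d m (A : 'M[R]_d) (B : 'M[R]_(d, m)) (C : 'M[R]_m) u v :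
  posdef (block_mx A B B^T C) ->
  (mvn_cdf (block_mx A B B^T C) (col_mx u v))%:E =
  (\int[vol d]_x (mvn_pdf A x * \1_(orthant u) x *
    mvn_cdf (schur A B C) (v - B^T *m invmx A *m x))%:E)%E.
Proof.
move=> pM.
have ge0 n (S : 'M[R]_n) w x : (0 <= (mvn_pdf S x * \1_(orthant w) x)%:E)%E.
  by rewrite lee_fin mulr_ge0// mvn_pdf_ge0.
have meas n (S : 'M[R]_n) w : measurable_fun setT
    (fun x => (mvn_pdf S x * \1_(orthant w) x)%:E).
  by apply/measurable_EFinP; exact: measurable_mvn_pdf_orthant.
rewrite mvn_cdfE// mvn_probE integral_col_mx//.
apply: eq_integral => x _.
rewrite [RHS]EFinM mvn_cdfE ?mvn_probE; last exact: posdef_schur.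
set k := B^T *m invmx A *m x.
pose g y := (mvn_pdf (schur A B C) y * \1_(orthant (v - k)) y)%:E.
rewrite -(@integral_shift _ g (- k)) /g// -ge0_integralZl//; last first.
  by apply: (measurableT_comp (meas _ _ _)); exact: measurable_cV_add.
apply: eq_integral => y _; rewrite -EFinM; congr EFin.
rewrite mvn_pdf_schur// -/k -[LHS]mulrA -[RHS]mulrA; congr (_ * _).
rewrite [in RHS]mulrCA; congr (_ * _).
rewrite !indicE -natrM mulnb; congr (nat_of_bool _)%:R.
have yvk : orthant (v - k) (y - k) <-> orthant v y.
  by split => h i; have := h i; rewrite /= !mxE lerD2r.
apply/idP/andP; rewrite !inE.
- by move/orthant_col_mx => -[ux vy]; split => //; exact/yvk.
- by move=> [ux /yvk vy]; exact/orthant_col_mx.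
Qed.

End mvn.

(** * Log-concavity of the normal distribution function *)

Section log_concavity.
Context {R : realType}.
Local Notation leb := (@lebesgue_measure R).
Local Notation vol n := (@lebesgue_cV R n).

Lemma powR_conv (c l : R) : 0 <= c -> c `^ l * c `^ (1 - l) = c.
Proof.
by move=> c0; rewrite -powRD addrC subrK; [exact: powRr1|rewrite oner_eq0].
Qed.

Definition log_concave (E : lmodType R) (F : E -> R) : Prop :=
  forall x y (l : R), 0 < l -> l < 1 ->
    F x `^ l * F y `^ (1 - l) <= F (l *: x + (1 - l) *: y).

Lemma log_concaveM (E : lmodType R) (F G : E -> R) :
  (forall x, 0 <= F x) -> (forall x, 0 <= G x) ->
  log_concave F -> log_concave G -> log_concave (fun x => F x * G x).
Proof.
move=> F0 G0 lF lG x y l l0 l1; rewrite !powRM// mulrACA.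
by rewrite ler_pM ?mulr_ge0 ?powR_ge0 ?lF ?lG.
Qed.

Lemma log_concaveMr (E : lmodType R) (F : E -> R) (c : R) :
  0 < c -> (forall x, 0 <= F x) -> log_concave F -> log_concave (fun x => F x * c).
Proof.
move=> c0 F0 lF; apply: log_concaveM => //; first by move=> _; exact: ltW.
by move=> _ _ l l0 l1; rewrite powR_conv// ltW.
Qed.

Lemma convex_comb_affine n m (K : 'M[R]_(m, n)) (b : 'cV[R]_m) (x y : 'cV[R]_n) (l : R) :
  K *m (l *: x + (1 - l) *: y) + b = l *: (K *m x + b) + (1 - l) *: (K *m y + b).
Proof.
rewrite mulmxDr -!scalemxAr !scalerDr addrACA -scalerDl.
by rewrite (addrC l) subrK scale1r.
Qed.

Lemma log_concave_affine n m (F : 'cV[R]_m -> R) (K : 'M[R]_(m, n)) (b : 'cV[R]_m) :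
  log_concave F -> log_concave (fun x : 'cV[R]_n => F (K *m x + b)).
Proof. by move=> lF x y l l0 l1; rewrite convex_comb_affine lF. Qed.

Lemma log_concave_ln (E : lmodType R) (F : E -> R) :
  (forall x, 0 < F x) -> log_concave F -> concave_function (fun x => ln (F x)).
Proof.
move=> F0 lF t x y _ _.
have [->|t0] := eqVneq t 0%:i01; first by rewrite !conv0.
have [->|t1] := eqVneq t 1%:i01; first by rewrite !conv1.
have {}t0 : 0 < t%:num by rewrite lt_neqAle eq_sym t0 ge0.
have {}t1 : t%:num < 1 by rewrite lt_neqAle t1 le1.
have := lF x y _ t0 t1.
rewrite -ler_ln ?posrE ?mulr_gt0 ?powR_gt0// lnM ?posrE ?powR_gt0// !ln_powR => le_ln.
rewrite convRE !mulrN -opprD lerN2.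
exact: le_ln.
Qed.

Lemma mvn_pdf_log_concave n (S : 'M[R]_n) : posdef S -> log_concave (mvn_pdf S).
Proof.
move=> pS x y l l0 l1; rewrite /mvn_pdf -!/(qform _ _ _).
set Q := qform (invmx S); set p := (Num.sqrt _)^-1.
have p0 : 0 < p by rewrite invr_gt0 sqrtr_gt0 mvn_normalizer_gt0.
have pW := ltW p0; rewrite !powRM ?expR_ge0// mulrACA powR_conv// ler_pM2l//.
rewrite -!expRM -expRD ler_expR.
have := qform_convex x y (fun v => posdef_ge0 v (posdef_inv pS)) (ltW l0) (ltW l1).
rewrite -/Q; lra.
Qed.

(** The integrand of [mvn_cdf_col_mx], as a function of the bound and of the
    first coordinate jointly, is log-concave by induction; Prekopa-Leindler
    integrates the coordinate out. *)
Lemma mvn_cdf_log_concave n (S : 'M[R]_n) : posdef S -> log_concave (mvn_cdf S).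
Proof.
move: n S; apply: posdef_ind => [S|n A B C pM IH] u v l l0 l1.
  have -> : u = v by apply/matrixP => -[].
  have -> : l *: v + (1 - l) *: v = v by apply/matrixP => -[].
  by rewrite powR_conv// mvn_cdf_ge0.
have pA := posdef_ul pM; have pS := posdef_schur pM.
pose k (t : R) : 'cV[R]_n := B^T *m invmx A *m const_mx t.
pose Phi (w : 'cV[R]_(1 + n)) (t : R) := mvn_pdf A (const_mx t) *
  \1_(orthant (usubmx w)) (const_mx t) * mvn_cdf (schur A B C) (dsubmx w - k t).
have Phi0 w t : 0 <= Phi w t by rewrite !mulr_ge0 ?mvn_pdf_ge0 ?mvn_cdf_ge0.
have mPhi w : measurable_fun setT (Phi w).
  have mc : measurable_fun setT (const_mx : R -> 'cV[R]_1) by exact: measurable_const_mx.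
  apply: measurable_funM.
    exact: (measurableT_comp (measurable_mvn_pdf_orthant A (usubmx w)) mc).
  apply: (measurableT_comp (measurable_mvn_cdf pS)).
  apply: measurable_cV_add => //; apply: measurable_cV_opp.
  exact: measurable_mulmx.
have PhiE w : (\int[leb]_t (Phi w t)%:E)%E = (mvn_cdf (block_mx A B B^T C) w)%:E.
  rewrite -[w in RHS]vsubmxK mvn_cdf_col_mx// integral_cV1//.
  - apply/measurable_EFinP/measurable_funM; first exact: measurable_mvn_pdf_orthant.
    apply: (measurableT_comp (measurable_mvn_cdf pS)).
    apply: measurable_cV_add => //; apply: measurable_cV_opp.
    exact: measurable_mulmx.
  - by move=> x; rewrite lee_fin !mulr_ge0 ?mvn_pdf_ge0 ?mvn_cdf_ge0.
have PhiM w t : Phi w t <= (Num.sqrt ((2 * pi) ^+ 1 * \det A))^-1.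
  rewrite -[leRHS]mulr1 -[leRHS]mulr1 ler_pM ?mvn_cdf_ge0 ?mulr_ge0 ?mvn_pdf_ge0 ?mvn_cdf_le1//.
  by rewrite ler_pM ?mvn_pdf_ge0 ?mvn_pdf_le// indicE; case: (_ \in _).
apply: (prekopa_leindler (mPhi u) (mPhi v) (mPhi _) (Phi0 u) (Phi0 v) (Phi0 _)
  (PhiM u) (PhiM v) (PhiE u) (PhiE v) (PhiE _)) => // s t.
set w := l *: u + _; set r := l * s + _.
(* outside its orthant an integrand vanishes, and so does the left-hand side *)
have [su|su] := pselect (orthant (usubmx u) (const_mx s)); last first.
  by rewrite {1}/Phi indicE memNset// mulr0 mul0r powR0 ?gt_eqF// mul0r.
have [tv|tv] := pselect (orthant (usubmx v) (const_mx t)); last first.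
  rewrite {2}/Phi indicE memNset// mulr0 mul0r (@powR0 _ (1 - l)) ?mulr0//.
  by rewrite gt_eqF// subr_gt0.
have l1' : 0 < 1 - l by rewrite subr_gt0.
have rw : orthant (usubmx w) (const_mx r).
  move=> i; have := su i; have := tv i; rewrite /w /r !mxE => tv' su'.
  by rewrite lerD// ler_pM2l.
have rE : const_mx r = l *: const_mx s + (1 - l) *: const_mx t :> 'cV[R]_1.
  by apply/matrixP => i j; rewrite !mxE.
have wE : dsubmx w - k r = l *: (dsubmx u - k s) + (1 - l) *: (dsubmx v - k t).
  rewrite /w linearD/= !linearZ/= /k rE mulmxDr -!scalemxAr.
  by rewrite opprD addrACA -!scalerBr.
rewrite /Phi !indicE !mem_set// !mulr1 wE rE.
rewrite 2!(powRM _ (mvn_pdf_ge0 _ _) (mvn_cdf_ge0 _ _)) mulrACA.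
by rewrite ler_pM ?mulr_ge0 ?powR_ge0// ?IH//; exact: mvn_pdf_log_concave.
Qed.

End log_concavity.

(** * The unified skew-normal law and its density *)

Section sun.
Context {R : realType}.
Local Notation leb := (@lebesgue_measure R).
Local Notation vol n := (@lebesgue_cV R n).

Definition tail n (tau : 'cV[R]_n) : set 'cV[R]_n :=
  [set y | forall i, 0 < (y + tau) i ord0].

Lemma measurable_tail n (tau : 'cV[R]_n) : measurable (tail tau).
Proof.
rewrite (_ : tail tau = [set y | forall i, [set` `]0, +oo[] ((y + tau) i ord0)]).
  apply: measurable_forall_coord => //.
  by apply: measurable_cV_add => //; exact: measurable_cst.
by apply/seteqP; split => x /= h i; have := h i; rewrite /= in_itv/= andbT.
Qed.

(** The reflection $y \mapsto k - y$ turns the tail event into an orthant, up to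
    the null set where some coordinate inequality is an equality. *)
Lemma integral_mvn_pdf_tail n (S : 'M[R]_n) (k tau : 'cV[R]_n) : posdef S ->
  (\int[vol n]_y (mvn_pdf S (y - k) * \1_(tail tau) y)%:E =
   (mvn_cdf S (tau + k))%:E)%E.
Proof.
move=> pS; rewrite mvn_cdfE// mvn_probE.
pose f y : \bar R := (mvn_pdf S (y - k) * \1_(tail tau) y)%:E.
have mf : measurable_fun setT f.
  apply/measurable_EFinP/measurable_funM; first exact: measurable_mvn_pdf_shift.
  by apply: measurable_indic; exact: measurable_tail.
have f0 y : (0 <= f y)%E by rewrite lee_fin mulr_ge0// mvn_pdf_ge0.
rewrite -[LHS](integral_reflect k mf f0).
apply: ge0_ae_eq_integral => //.
- by apply: (measurableT_comp mf); apply: measurable_cV_add => //; exact: measurable_cV_opp.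
- by apply/measurable_EFinP; exact: measurable_mvn_pdf_orthant.
- by move=> y _; rewrite lee_fin mulr_ge0// mvn_pdf_ge0.
have off_boundary : {ae vol n, forall y : 'cV[R]_n, forall i, y i ord0 != (tau + k) i ord0}.
  apply: filter_forall => i.
  exists [set y : 'cV[R]_n | y i ord0 = (tau + k) i ord0]; split.
  - rewrite -[X in measurable X]setTI.
    exact: (@measurable_coord R n i measurableT _ (measurable_set1 _)).
  - exact: lebesgue_cV_hyperplane.
  - by move=> y /= /negP; rewrite negbK => /eqP.
apply: filterS off_boundary => y yb _; congr EFin.
rewrite addrAC subrr add0r mvn_pdfN; congr (_ * _); rewrite !indicE.
congr (nat_of_bool _)%:R; apply/idP/idP; rewrite !inE /tail /orthant /= => h i.
  have := h i; rewrite !mxE; lra.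
have := h i; have := yb i; rewrite !mxE => yi; rewrite le_eqVlt (negbTE yi)/=; lra.
Qed.

Lemma measurable_selection d m (D : set 'cV[R]_d) (tau : 'cV[R]_m) : measurable D ->
  measurable ([set x : 'cV[R]_(d + m) | D (usubmx x)] `&` [set x | tail tau (dsubmx x)]).
Proof.
move=> mD; apply: measurableI; rewrite -[X in measurable X]setTI.
- exact: (@measurable_usubmx R d m measurableT _ mD).
- exact: (@measurable_dsubmx R d m measurableT _ (measurable_tail tau)).
Qed.

Section selection.
Context {d m : nat} (A : 'M[R]_d) (B : 'M[R]_(d, m)) (C : 'M[R]_m).
Context (pM : posdef (block_mx A B B^T C)).
Local Notation M := (block_mx A B B^T C).

Let split_joint (D : set 'cV[R]_d) (tau : 'cV[R]_m) : measurable D ->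
  mvn_prob M ([set x | D (usubmx x)] `&` [set x | tail tau (dsubmx x)]) =
  (\int[vol d]_x \int[vol m]_y
    (mvn_pdf M (col_mx x y) * (\1_D x * \1_(tail tau) y))%:E)%E.
Proof.
move=> mD; rewrite mvn_probE integral_col_mx; last 2 first.
- apply/measurable_EFinP/measurable_funM; first exact: measurable_mvn_pdf.
  by apply: measurable_indic; exact: measurable_selection.
- by move=> x; rewrite lee_fin mulr_ge0// mvn_pdf_ge0.
apply: eq_integral => x _; apply: eq_integral => y _; congr (_ * _)%:E.
rewrite !indicE -natrM mulnb; congr (nat_of_bool _)%:R.
by apply/idP/andP; rewrite !inE /= col_mxKu col_mxKd.
Qed.

(** Given $X_0 = x$, the vector $X_1$ is normal with mean $B^T A^{-1} x$ and
    covariance the Schur complement. *)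
Lemma mvn_prob_selection (D : set 'cV[R]_d) (tau : 'cV[R]_m) : measurable D ->
  mvn_prob M ([set x | D (usubmx x)] `&` [set x | tail tau (dsubmx x)]) =
  (\int[vol d]_x (mvn_pdf A x *
     mvn_cdf (schur A B C) (tau + B^T *m invmx A *m x) * \1_D x)%:E)%E.
Proof.
move=> mD; rewrite split_joint//; apply: eq_integral => x _.
set k := B^T *m invmx A *m x.
rewrite mulrAC EFinM -integral_mvn_pdf_tail; last exact: posdef_schur.
rewrite -ge0_integralZl//; last 3 first.
- apply/measurable_EFinP/measurable_funM; first exact: measurable_mvn_pdf_shift.
  by apply: measurable_indic; exact: measurable_tail.
- by move=> y _; rewrite lee_fin mulr_ge0// mvn_pdf_ge0.
- by rewrite lee_fin mulr_ge0// mvn_pdf_ge0.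
apply: eq_integral => y _; rewrite -EFinM; congr EFin.
by rewrite mvn_pdf_schur// -/k mulrACA.
Qed.

(** The other order of integration, which shows that $X_1$ has law $N(0, C)$. *)
Lemma mvn_prob_tail (tau : 'cV[R]_m) :
  mvn_prob M [set x | tail tau (dsubmx x)] = (mvn_cdf C tau)%:E.
Proof.
have pC := posdef_dr pM.
have -> : [set x : 'cV[R]_(d + m) | tail tau (dsubmx x)] =
    [set x | setT (usubmx x)] `&` [set x | tail tau (dsubmx x)].
  by apply/seteqP; split => x //= -[].
rewrite split_joint//.
rewrite (fubini_tonelli (fun p : 'cV[R]_d * 'cV[R]_m =>
   (mvn_pdf M (col_mx p.1 p.2) * (\1_setT p.1 * \1_(tail tau) p.2))%:E : \bar R))/=; last 2 first.
- apply/measurable_EFinP/measurable_funM.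
    apply: (measurableT_comp (measurable_mvn_pdf _)).
    exact: (measurable_col_mx measurable_fst measurable_snd).
  apply: measurable_funM.
    exact: (measurableT_comp (measurable_indic _) measurable_fst).
  exact: (measurableT_comp (measurable_indic (measurable_tail tau)) measurable_snd).
- by move=> p; rewrite lee_fin !mulr_ge0// mvn_pdf_ge0.
rewrite -[tau in RHS]addr0 -integral_mvn_pdf_tail//.
apply: eq_integral => y _; rewrite subr0.
have pM' : posdef (block_mx C B^T B^T^T A) by rewrite trmxK; exact: posdef_swap.
pose k := B^T^T *m invmx C *m y.
transitivity (\int[vol d]_x ((mvn_pdf C y * \1_(tail tau) y)%:E *
   (mvn_pdf (schur C B^T A) (x - k))%:E))%E.
  apply: eq_integral => x _; rewrite -EFinM; congr EFin.
  rewrite mvn_pdf_block_swap//.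
  have -> : block_mx C B^T B A = block_mx C B^T B^T^T A by rewrite trmxK.
  by rewrite mvn_pdf_schur// -/k indicT mul1r mulrAC.
rewrite ge0_integralZl//; last 3 first.
- by apply/measurable_EFinP; exact: measurable_mvn_pdf_shift.
- by move=> x _; rewrite lee_fin mvn_pdf_ge0.
- by rewrite lee_fin mulr_ge0// mvn_pdf_ge0.
rewrite (@integral_shift _ _ (fun x => (mvn_pdf (schur C B^T A) x)%:E)); last 2 first.
- by apply/measurable_EFinP; exact: measurable_mvn_pdf.
- by move=> x; rewrite lee_fin mvn_pdf_ge0.
by rewrite integral_mvn_pdf ?mule1//; exact: posdef_schur.
Qed.

End selection.

(** The change of variables formula for the density: $W x$ has covariance
    $W S W^T$. *)
Lemma mvn_pdf_mulmx n (S W : 'M[R]_n) (x : 'cV[R]_n) : posdef S -> W \in unitmx ->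
  `|\det W| * mvn_pdf (W *m S *m W^T) (W *m x) = mvn_pdf S x.
Proof.
move=> pS uW; have uS := posdef_unitmx pS.
rewrite /mvn_pdf -!/(qform _ _ _).
have -> : qform (invmx (W *m S *m W^T)) (W *m x) (W *m x) = qform (invmx S) x x.
  rewrite (@qform_dot _ _ _ _ (invmx W^T *m (invmx S *m x))).
  - by rewrite trmx_mul /qform !mulmxA mulmxK ?unitmx_tr.
  - by rewrite !unitmx_mul unitmx_tr uW uS.
  - by rewrite -!mulmxA mulKVmx ?unitmx_tr// mulKVmx.
rewrite mulrA; congr (_ * _).
rewrite !det_mulmx det_tr.
have -> : (2 * pi) ^+ n * (\det W * \det S * \det W) =
    `|\det W| ^+ 2 * ((2 * pi) ^+ n * \det S) :> R.
  by rewrite real_normK ?num_real//; ring.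
rewrite sqrtrM ?sqr_ge0// sqrtr_sqr normr_id invfM mulVKf//.
by rewrite normr_eq0 -unitfE -unitmxE.
Qed.

End sun.

Lemma is_diag_mx_sym (R : realType) n (W : 'M[R]_n) : is_diag_mx W -> W^T = W.
Proof. by move=> /diag_mxP[c ->]; rewrite tr_diag_mx. Qed.

Lemma is_diag_mx_unit (R : realType) n (W : 'M[R]_n) :
  is_diag_mx W -> (forall i, 0 < W i i) -> W \in unitmx.
Proof.
move=> /diag_mxP[c Wc] W_gt0.
rewrite unitmxE Wc det_diag unitfE; apply/prodf_neq0 => i _.
by have := W_gt0 i; rewrite Wc mxE eqxx mulr1n => /lt0r_neq0.
Qed.

Section sun_density.
Context {R : realType} {d m : nat}.
Context (Obar : 'M[R]_d) (Delta : 'M[R]_(d, m)) (Gamma : 'M[R]_m).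
Context (pM : posdef (block_mx Obar Delta Delta^T Gamma)).
Context (tau : 'cV[R]_m) (xi : 'cV[R]_d) (omega : 'M[R]_d).
Context (omega_diag : is_diag_mx omega) (omega_gt0 : forall i, 0 < omega i i).
Local Notation vol n := (@lebesgue_cV R n).
Local Notation f_Y := (sun_pdf xi omega Obar Delta tau Gamma).

Lemma posdef_scaled : posdef (omega *m Obar *m omega).
Proof.
rewrite -{1}(is_diag_mx_sym omega_diag); apply: posdef_congr.
  exact: is_diag_mx_unit.
exact: posdef_ul pM.
Qed.

Lemma sun_pdf_gt0 x : 0 < f_Y x.
Proof.
rewrite mulr_gt0 ?divr_gt0//.
- exact/mvn_pdf_gt0/posdef_scaled.
- exact/mvn_cdf_gt0/(posdef_schur pM).
- exact/mvn_cdf_gt0/(posdef_dr pM).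
Qed.

Lemma measurable_sun_pdf : measurable_fun setT f_Y.
Proof.
apply: measurable_funM; first exact: measurable_mvn_pdf_shift.
apply: measurable_funM => //.
apply: (measurableT_comp (measurable_mvn_cdf (posdef_schur pM))).
apply: measurable_cV_add => //; apply: measurable_mulmx.
exact: measurable_cV_add.
Qed.

(** The substitution $x = \omega z + \xi$ turns the integral of $f_Y$ over $A$
    into the one of [mvn_prob_selection]; the conditioning event has the
    probability given by [mvn_prob_tail]. *)
Lemma sun_law_density (A : set 'cV[R]_d) : measurable A ->
  sun_law xi omega Obar Delta tau Gamma A = (\int[vol d]_(x in A) (f_Y x)%:E)%E.
Proof.
move=> mA; have pO := posdef_ul pM; have uw := is_diag_mx_unit omega_diag omega_gt0.
pose D := [set z | A (xi + omega *m z)].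
have mD : measurable D.
  rewrite -[X in measurable X]setTI.
  suff mphi : measurable_fun setT (fun z : 'cV[R]_d => xi + omega *m z) by exact: mphi.
  by apply: measurable_cV_add => //; exact: measurable_mulmx.
pose g x : \bar R := (f_Y x * \1_A x)%:E.
have -> : (\int[vol d]_(x in A) (f_Y x)%:E = \int[vol d]_x g x)%E.
  rewrite integral_mkcond; apply: eq_integral => x _.
  by rewrite patchE /g indicE; case: ifPn => _; rewrite ?mulr1 ?mulr0.
have mg : measurable_fun setT g.
  apply/measurable_EFinP/measurable_funM; first exact: measurable_sun_pdf.
  exact: measurable_indic.
have g0 x : (0 <= g x)%E by rewrite lee_fin mulr_ge0// ltW// sun_pdf_gt0.
pose joint := [set x : 'cV[R]_(d + m) | D (usubmx x)] `&`
  [set x | tail tau (dsubmx x)].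
have /diag_mxP[c oc] := omega_diag.
rewrite -(@integral_affine_cV _ _ g c xi)//; last first.
  by move=> i; have := omega_gt0 i; rewrite oc mxE eqxx mulr1n => /lt0r_neq0.
rewrite -oc -ge0_integralZl//; last first.
  apply: (measurableT_comp mg); apply: measurable_cV_add => //.
  exact: measurable_mulmx.
transitivity ((fine (mvn_prob (block_mx Obar Delta Delta^T Gamma) joint))%:E *
  ((mvn_cdf Gamma tau)^-1)%:E)%E.
  rewrite -EFinM; congr (_ / _)%:E.
  by have := mvn_prob_tail pM tau => /(congr1 fine).
have nFin : mvn_prob (block_mx Obar Delta Delta^T Gamma) joint \is a fin_num.
  by apply: mvn_prob_fin_num => //; exact: measurable_selection.
rewrite fineK// mvn_prob_selection// -ge0_integralZr//; last 3 first.
- apply/measurable_EFinP/measurable_funM; last exact: measurable_indic.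
  apply: measurable_funM; first exact: measurable_mvn_pdf.
  apply: (measurableT_comp (measurable_mvn_cdf (posdef_schur pM))).
  by apply: measurable_cV_add => //; exact: measurable_mulmx.
- by move=> x _; rewrite lee_fin !mulr_ge0 ?mvn_pdf_ge0 ?mvn_cdf_ge0.
- by rewrite lee_fin invr_ge0 mvn_cdf_ge0.
apply: eq_integral => x _; rewrite /g -!EFinM; congr EFin.
rewrite /sun_pdf addrK -(mvn_pdf_mulmx x pO uw) is_diag_mx_sym//.
rewrite -[_ *m invmx omega *m _]mulmxA mulKmx//.
have -> : \1_A (omega *m x + xi) = \1_D x :> R.
  by rewrite !indicE /D; congr (nat_of_bool _)%:R; rewrite addrC; apply/idP/idP; rewrite !inE.
rewrite -/(schur Obar Delta Gamma); ring.
Qed.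

Lemma sun_pdf_log_concave : log_concave f_Y.
Proof.
have [pO [pS pG]] := (posdef_scaled, (posdef_schur pM, posdef_dr pM)).
apply: log_concaveM.
- by move=> x; exact: mvn_pdf_ge0.
- by move=> x; rewrite divr_ge0// mvn_cdf_ge0.
- have := log_concave_affine 1%:M (- xi) (mvn_pdf_log_concave pO).
  by under eq_fun do rewrite mul1mx.
apply: log_concaveMr; first by rewrite invr_gt0 mvn_cdf_gt0.
  by move=> x; exact: mvn_cdf_ge0.
pose K := Delta^T *m invmx Obar *m invmx omega.
have := log_concave_affine K (tau - K *m xi) (mvn_cdf_log_concave pS).
by congr log_concave; apply/funext => x; rewrite mulmxBr addrCA.
Qed.

End sun_density.

Theorem proposition3 (R : realType) (d m : nat)
    (d_gt0 : (0 < d)%N) (m_gt0 : (0 < m)%N)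
    (Obar : 'M[R]_d) (Delta : 'M[R]_(d, m)) (Gamma : 'M[R]_m)
    (corr : correlation_mx (block_mx Obar Delta Delta^T Gamma))
    (full_rank : row_free (block_mx Obar Delta Delta^T Gamma))
    (tau : 'cV[R]_m) (xi : 'cV[R]_d)
    (omega : 'M[R]_d) (omega_diag : is_diag_mx omega)
    (omega_gt0 : forall i, 0 < omega i i)
    (disp : measure_display) (T : measurableType disp) (P : probability T R)
    (Y : {RV P >-> 'cV[R]_d})
    (Y_sun : forall A : set 'cV[R]_d, measurable A ->
       distribution P Y A = sun_law xi omega Obar Delta tau Gamma A) :
  let f_Y := sun_pdf xi omega Obar Delta tau Gamma in
  [/\ has_density Y f_Y,
      (forall x, 0 < f_Y x) &
      concave_function (fun x => ln (f_Y x))].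
Proof.
have [sym _ psd] := corr.
have pM : posdef (block_mx Obar Delta Delta^T Gamma).
  by apply: psd_unitmx_posdef => //; rewrite -row_free_unit.
have f_gt0 := sun_pdf_gt0 pM tau xi omega_diag omega_gt0.
move=> f_Y; split => //; last exact/log_concave_ln/sun_pdf_log_concave.
split; first exact: measurable_sun_pdf.
- by move=> x; exact/ltW/f_gt0.
- by move=> A mA; rewrite Y_sun// sun_law_density.
Qed.
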